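(* Let $n \ge 1$ be an integer, $\alpha\in(0,1)$, $s\in(0,1)$, and $p\ge 1$ be such that $n > sp$. Let $\Omega\subset\mathbb{R}^{n+1}$ be an open convex set. Then there exists a constant $C$, depending only on $n$, $\alpha$, $s$, and $p$ (and not on $\Omega$), such that $$\|u\|_{L^{p^*_s}(\partial\Omega)}\le C\left(\frac12\int_{\partial\Omega}\int_{\partial\Omega}\frac{|u(x)-u(y)|^p}{|x-y|^{n+sp}}\,dx\,dy+\int_{\partial\Omega}H_\alpha(x)^{\frac{sp}{\alpha}}|u(x)|^p\,dx\right)^{\frac1p}$$ for every $u\in W^{s,p}(\partial\Omega)$, where $p^*_s=np/(n-sp)$. As a consequence (taking $p=1$ and $u$ to be the characteristic function of a set $E$), there is a constant $C$ depending only on $n$, $\alpha$, and $s$ such that $$|E|^{\frac{n-s}{n}}\le C\left(\mathrm{Per}_{\partial\Omega,s}(E)+\int_E H_\alpha(x)^{\frac{s}{\alpha}}\,dx\right)$$ for every measurable subset $E\subset\partial\Omega$ with finite measure. In particular, if $\partial\Omega$ has finite measure, the choice $E=\partial\Omega$ gives $$|\partial\Omega|^{\frac{n-s}{n}}\le C\int_{\partial\Omega}H_\alpha(x)^{\frac{s}{\alpha}}\,dx.$$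
   Context: On the hypersurface $M=\partial\Omega\subset\mathbb{R}^{n+1}$, $|E|$ denotes the $n$-dimensional Hausdorff measure of $E\subset M$, $dx$ and $dy$ denote integration with respect to this measure, and ''measurable'' refers to it; $|x-y|$ is the Euclidean distance in $\mathbb{R}^{n+1}$. Since $\Omega$ is open and convex, $\partial\Omega$ is a locally Lipschitz hypersurface, so its exterior unit normal $\nu(y)$ exists for almost every $y\in\partial\Omega$. The nonlocal (fractional) $\alpha$-mean curvature of $\Omega$ at $x\in\partial\Omega$ is $$H_\alpha(x)=H_\alpha[\Omega](x)=\frac{\alpha}{2}\,\mathrm{P.V.}\int_{\mathbb{R}^{n+1}}\frac{\chi_{\mathbb{R}^{n+1}\setminus\Omega}(y)-\chi_\Omega(y)}{|y-x|^{n+1+\alpha}}\,dy=\mathrm{P.V.}\int_{\partial\Omega}\frac{(y-x)\cdot\nu(y)}{|y-x|^{n+1+\alpha}}\,dy,$$ where P.V. denotes the principal value (the first integral is with respect to Lebesgue measure in $\mathbb{R}^{n+1}$). For convex $\Omega$ the last integrand is non-negative, so $H_\alpha(x)$ is well defined in $[0,+\infty]$; it is finite for almost every $x\in\partial\Omega$. $W^{s,p}(\partial\Omega)$ is the set of $u\in L^p(\partial\Omega)$ for which $[u]_{W^{s,p}(\partial\Omega)}=\left(\int_{\partial\Omega}\int_{\partial\Omega}\frac{|u(x)-u(y)|^p}{|x-y|^{n+sp}}\,dx\,dy\right)^{1/p}$ is finite. For $F\subset M$, the nonlocal $s$-perimeter on $M$ is $\mathrm{Per}_{M,s}(F)=\int_F\int_{M\setminus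 F}\frac{dx\,dy}{|x-y|^{n+s}}$. The right-hand sides of the inequalities are allowed to be $+\infty$. *)

(* Defs.v *)
From HB Require Import structures.
From mathcomp Require Import all_boot all_order all_algebra.
From mathcomp Require Import all_classical all_reals all_analysis.

Set Implicit Arguments.
Unset Strict Implicit.
Unset Printing Implicit Defensive.
Import Order.TTheory GRing.Theory Num.Theory.
Import numFieldNormedType.Exports.

Local Open Scope classical_set_scope.
Local Open Scope ring_scope.

Section cover_outer.
Local Open Scope ereal_scope.
Context (R : realType) (T I : Type).
Variables (D : set I) (E : I -> set T) (c : I -> \bar R).

Definition cover_outer (X : set T) : \bar R :=
  ereal_inf [set \sum_(k <oo) c (f k) | f in
    [set f : nat -> I | (forall k, D (f k)) /\ X `<=` \bigcup_k E (f k)]].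

Hypothesis c_ge0 : forall i, D i -> 0 <= c i.

Lemma cover_outer_ge0 X : 0 <= cover_outer X.
Proof.
by apply: le_ereal_inf_tmp => _ [f [Df _] <-]; apply: nneseries_ge0 => k _ _;
  exact: c_ge0.
Qed.

Lemma le_cover_outer : {homo cover_outer : A B / A `<=` B >-> A <= B}.
Proof.
move=> A B AB; apply/ereal_inf_le_tmp => x [f [Df Bf]] <-.
by exists f => //; split => //; exact: subset_trans AB Bf.
Qed.

Lemma cover_outer0 i0 : D i0 -> c i0 = 0 -> cover_outer set0 = 0.
Proof.
move=> Di0 ci0; apply/eqP; rewrite eq_le cover_outer_ge0 andbT.
apply: ereal_inf_lbound; exists (fun=> i0); first by split.
by rewrite eseries0.
Qed.

Lemma cover_outer_sigma_subadditive : sigma_subadditive cover_outer.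
Proof.
move=> A; have [[i ioo]|] := pselect (exists i, cover_outer (A i) = +oo).
  rewrite (eseries_pinfty _ _ ioo) ?leey// => n _.
  by rewrite -ltNye (lt_le_trans _ (cover_outer_ge0 _)).
rewrite -forallNE => Aoo.
suff add2e (e : {posnum R}) : cover_outer (\bigcup_n A n) <=
    \sum_(i <oo) cover_outer (A i) + e%:num%:E.
  by apply/lee_addgt0Pr => _/posnumP[].
rewrite (le_trans _ (epsilon_trick _ _ _))//; last first.
  by move=> n; exact: cover_outer_ge0.
pose P n (f : nat -> I) :=
  ((forall k, D (f k)) /\ A n `<=` \bigcup_k E (f k)) /\
  \sum_(k <oo) c (f k) <= cover_outer (A n) + (e%:num / (2 ^ n.+1)%:R)%:E.
have [G PG] : {G : nat -> nat -> I & forall n, P n (G n)}.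
  apply: (@choice _ _ P) => n; rewrite /P /cover_outer.
  set S := (X in ereal_inf X); move infS : (ereal_inf S) => iS.
  case: iS infS => [r Sr|Soo|Soo].
  - have en1 : (0 < e%:num / (2 ^ n.+1)%:R)%R by [].
    have /(lb_ereal_inf_adherent en1) : ereal_inf S \is a fin_num by rewrite Sr.
    move=> [x [B [mB AnB] muBx] xS].
    by exists B; split => //; rewrite muBx -Sr; exact/ltW.
  - by have := Aoo n; rewrite /cover_outer Soo.
  - suff : lbound S 0 by move/le_ereal_inf_tmp; rewrite Soo.
    by move=> /= _ [B [mB AnB] <-]; apply: nneseries_ge0 => k _ _; exact: c_ge0.
have cG_ge0 x : 0 <= (c \o uncurry G) x.
  by case: x => i j; apply: c_ge0; exact: (PG i).1.1.
apply: (@le_trans _ _ (\esum_(i in setT) (c \o uncurry G) i)).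
  rewrite /cover_outer; apply: ereal_inf_lbound => /=.
  have /card_esym/ppcard_eqP[f] := card_nat2.
  exists (uncurry G \o f).
    split => [i|].
      by rewrite /=; case: (f i) => a b; exact: (PG a).1.1.
    move=> t [i _ /(PG i).1.2[j _ Bijt]].
    by exists (f^-1%FUN (i, j)) => //=; rewrite invK ?inE.
  rewrite -(esum_pred_image (c \o uncurry G) _ xpredT) ?[fun=> _]set_true//.
  by rewrite image_eq.
rewrite (_ : esum _ _ = \sum_(i <oo) \sum_(j <oo ) c (G i j)); last first.
  pose J : nat -> set (nat * nat) := fun i => [set (i, j) | j in setT].
  rewrite (_ : setT = \bigcup_k J k); last first.
    by rewrite predeqE => -[a b]; split => // _; exists a => //; exists b.
  rewrite esum_bigcupT /=; last 2 first.
    - apply/trivIsetP => i j _ _ ij.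
      rewrite predeqE => -[n m] /=; split => //= -[] [_] _ [<-{n} _].
      by move=> [m' _] [] /esym/eqP; rewrite (negbTE ij).
    - by move=> i; exact: cG_ge0.
  rewrite -(image_id [set: nat]) -fun_true esum_pred_image//; last first.
    by move=> n _; apply: esum_ge0 => i _; exact: cG_ge0.
  apply: eq_eseriesr => /= j _.
  rewrite -(esum_pred_image (c \o uncurry G) (pair j) predT)//=; last first.
    by move=> ? ? _ _; exact: (@can_inj _ _ _ snd).
    by move=> n _; exact: (cG_ge0 (j, n)).
  by congr esum; rewrite predeqE => -[a b]; split; move=> [i _ <-]; exists i.
apply: lee_lim.
- apply: is_cvg_nneseries => n *.
  by apply: nneseries_ge0 => m *; exact: (cG_ge0 (n, m)).
- apply: is_cvg_nneseries => n *; apply: adde_ge0; last by [].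

  exact: cover_outer_ge0.
- by near=> n; apply: lee_sum => i _; exact: (PG i).2.
Unshelve. all: by end_near. Qed.

End cover_outer.

(* The library's norm on row vectors is the sup norm (same topology). *)
Definition edist (R : realType) (d : nat) (x y : 'rV[R]_d) : R :=
  Num.sqrt (\sum_(i < d) (x ord0 i - y ord0 i) ^+ 2).

Section lebesgue_rV.
Local Open Scope ereal_scope.
Context (R : realType) (d : nat).
Local Notation V := 'rV[R]_d.+1.

Definition box (ab : V * V) : set V :=
  [set x | forall i, (ab.1 ord0 i < x ord0 i <= ab.2 ord0 i)%R].

Definition box_volume (ab : V * V) : \bar R :=
  (\prod_(i < d.+1) (ab.2 ord0 i - ab.1 ord0 i))%:E.

Definition lebesgue_cover : set V -> \bar R :=
  cover_outer [set ab : V * V | forall i, (ab.1 ord0 i <= ab.2 ord0 i)%R]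
    box box_volume.

Let box_volume_ge0 (ab : V * V) :
  (forall i, (ab.1 ord0 i <= ab.2 ord0 i)%R) -> 0 <= box_volume ab.
Proof. by move=> le_ab; rewrite lee_fin prodr_ge0// => i _; rewrite subr_ge0. Qed.

Let lebesgue_cover0 : lebesgue_cover set0 = 0.
Proof.
apply: (cover_outer0 _ box_volume_ge0 (i0 := (0%R, 0%R))) => //=.
by rewrite /box_volume big_ord_recl /= subrr mul0r.
Qed.

HB.instance Definition _ := isOuterMeasure.Build R V lebesgue_cover
  lebesgue_cover0 (cover_outer_ge0 _ box_volume_ge0)
  (@le_cover_outer _ _ _ _ _ _) (cover_outer_sigma_subadditive _ box_volume_ge0).

Definition lebesgue_outer : {outer_measure set V -> \bar R} := lebesgue_cover.

Definition lebesgue_rV :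
    {measure set (caratheodory_type lebesgue_outer) -> \bar R} :=
  lebesgue_outer.

End lebesgue_rV.

(* Volume of the unit ball of R^k, i.e. pi^(k/2) / Gamma(k/2 + 1). *)
Fixpoint ball_volume (R : realType) (k : nat) : R :=
  match k with
  | 0 => 1
  | 1 => 2
  | (k'.+1 as k1).+1 => 2 * pi / k1.+1%:R * ball_volume R k'
  end.

Lemma ball_volume_ge0 (R : realType) (k : nat) : 0 <= ball_volume R k.
Proof.
suff [] : 0 <= ball_volume R k /\ 0 <= ball_volume R k.+1 by [].
elim: k => [|k [vk vk1]] //=; split => //.
by rewrite mulr_ge0// divr_ge0// mulr_ge0// pi_ge0.
Qed.

Section hausdorff.
Local Open Scope ereal_scope.
Context (R : realType) (d k : nat).
Local Notation V := 'rV[R]_d.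

Definition ediameter (U : set V) : \bar R :=
  ereal_sup [set (edist xy.1 xy.2)%:E | xy in U `*` U].

(* The diameter of set0 is -oo here, whence the separate case. *)
Definition hausdorff_gauge (U : set V) : \bar R :=
  if U == set0 then 0
  else (ball_volume R k)%:E * (2^-1%:E * ediameter U) ^+ k.

Definition hausdorff_pre (delta : R) : set V -> \bar R :=
  cover_outer [set U | ediameter U <= delta%:E] id hausdorff_gauge.

Definition hausdorff_cover (X : set V) : \bar R :=
  ereal_sup [set hausdorff_pre delta X | delta in [set e | (0 < e)%R]].

Let hausdorff_gauge_ge0 U : 0 <= hausdorff_gauge U.
Proof.
rewrite /hausdorff_gauge; case: eqVneq => // /set0P[x Ux].
rewrite mule_ge0 ?lee_fin ?ball_volume_ge0// expe_ge0// mule_ge0//.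
by apply: ereal_sup_ubound; exists (x, x) => //=; congr EFin;
  rewrite /edist big1 ?sqrtr0// => i _; rewrite subrr expr0n.
Qed.

Let pre_ge0 delta X : 0 <= hausdorff_pre delta X.
Proof. exact: cover_outer_ge0. Qed.

Let hausdorff_cover0 : hausdorff_cover set0 = 0.
Proof.
rewrite /hausdorff_cover (_ : [set _ | _ in _] = [set 0]) ?ereal_sup1//.
have pre0 delta : hausdorff_pre delta set0 = 0.
  apply: (cover_outer0 _ _ (i0 := set0)) => //=.
    by rewrite /ediameter set0X image_set0 ereal_sup0 leNye.
  by rewrite /hausdorff_gauge eqxx.
by apply/seteqP; split => [_ [delta _ <-]|_ ->] /=; [|exists 1%R].
Qed.

Let hausdorff_cover_ge0 X : 0 <= hausdorff_cover X.
Proof.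
by apply: (le_trans (pre_ge0 1%R X)); apply: ereal_sup_ubound; exists 1%R => /=.
Qed.

Let le_hausdorff_cover : {homo hausdorff_cover : A B / A `<=` B >-> A <= B}.
Proof.
move=> A B AB; apply: ge_ereal_sup => _ [e e0 <-].
apply: (le_trans (le_cover_outer _ _ _ AB)).
by apply: ereal_sup_ubound; exists e.
Qed.

Let hausdorff_cover_sigma_subadditive : sigma_subadditive hausdorff_cover.
Proof.
move=> F; apply: ge_ereal_sup => _ [e e0 <-].
apply: (@le_trans _ _ (\sum_(i <oo) hausdorff_pre e (F i))).
  exact: cover_outer_sigma_subadditive.
apply: lee_nneseries => // i _.
by apply: ereal_sup_ubound; exists e.
Qed.

HB.instance Definition _ := isOuterMeasure.Build R V hausdorff_cover
  hausdorff_cover0 hausdorff_cover_ge0 le_hausdorff_cover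
  hausdorff_cover_sigma_subadditive.

Definition hausdorff_outer : {outer_measure set V -> \bar R} := hausdorff_cover.

Definition hausdorff :
    {measure set (caratheodory_type hausdorff_outer) -> \bar R} :=
  hausdorff_outer.

End hausdorff.

Definition boundary (T : topologicalType) (A : set T) : set T :=
  closure A `\` A°.

Section hypersurface.
Local Open Scope ereal_scope.
Context (R : realType) (n : nat).
Local Notation V := 'rV[R]_n.+1.

Definition surface_measure := @hausdorff R n.+1 n.
Local Notation sigma := surface_measure.

(* The limit is the principal value. When Omega is open and convex and x lies on
   its boundary, the truncated integrals are nonnegative and nonincreasing in e,
   so that it exists in [0, +oo]. *)
Definition nonlocal_mean_curvature (alpha : R) (Omega : set V) (x : V) : \bar R :=
  (alpha / 2)%:E *
  lim ((\int[@lebesgue_rV R n]_(y in [set y | (e <= edist y x)%R])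
          ((\1_(~` Omega) y - \1_Omega y)
             / (edist y x `^ (n.+1%:R + alpha)))%:E)
       @[e --> (0 : R)^'+]).

(* Functions on M are represented by functions on the whole space, whose values
   outside M are irrelevant. *)
Definition Lp_norm (p : R) (M : set V) (u : V -> R) : \bar R :=
  'N[sigma]_(p%:E)[(EFin \o u) \_ M].

(* The p-th power of the seminorm of W^{s,p}. *)
Definition gagliardo_energy (s p : R) (M : set V) (u : V -> R) : \bar R :=
  \int[sigma]_(y in M) \int[sigma]_(x in M)
    (`|u x - u y| `^ p / (edist x y `^ (n%:R + s * p)))%:E.

Definition frac_sobolev (s p : R) (M : set V) : set (V -> R) :=
  [set u | [/\ measurable_fun (M : set (caratheodory_type _))
                 (u : caratheodory_type (@hausdorff_outer R n.+1 n) -> R),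
               Lp_norm p M u < +oo &
               gagliardo_energy s p M u `^ p^-1 < +oo]].

Definition nonlocal_perimeter (s : R) (M F : set V) : \bar R :=
  \int[sigma]_(y in F) \int[sigma]_(x in M `\` F)
    ((edist x y `^ (n%:R + s))^-1)%:E.

End hypersurface.

Definition sobolev_exponent (R : realType) (n : nat) (s p : R) : R :=
  n%:R * p / (n%:R - s * p).

(* Main.v *)
(* Let x be a boundary point. By convexity Omega is disjoint from its reflection across x, so the two
   cancel in the principal value and the curvature at x is alpha times the integral of the kernel over
   half of the points outside both. For each r this yields a dichotomy with dimensional constants:
   either the boundary has measure at least c r^n in the ball of radius r around x, or the curvature is
   at least c r^(-alpha).

   If x belongs to a set B of surface measure m, choose r with c r^n = 4m. In the first case
   at least half of the boundary in the ball lies outside B, so the kernel |x - y|^(-n-t) integrates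
   over the complement of B to at least c m^(-t/n); in the second case H_alpha^(t/alpha) is at least
   c m^(-t/n). Integrating over B proves the isoperimetric inequality.

   For the Sobolev inequality put q = p*_s, truncate v = min(|u|, L), and let J be the integral of v^q.
   The set B_x where v > v(x)/2 has measure at most J (2/v(x))^q by Chebyshev, and |u(x) - u(z)| is at
   least v(x)/2 off B_x. The same bound with t = sp, multiplied by v(x)^p, gives pointwise
   c J^(-sp/n) v(x)^q, whose integral is c J^((n-sp)/n). The truncation makes J finite, so that it can
   be divided out; then L tends to infinity. *)

Require Import Defs.
From HB Require Import structures.
From mathcomp Require Import all_boot all_order all_algebra.
From mathcomp Require Import all_classical all_reals all_analysis.
From mathcomp Require Import measurable_realfun ring lra.

Import Order.TTheory GRing.Theory Num.Theory.
Import numFieldNormedType.Exports.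

Local Open Scope classical_set_scope.
Local Open Scope ring_scope.
Local Open Scope ereal_scope.

Local Notation edist := Defs.edist.

Set Implicit Arguments.
Unset Strict Implicit.
Unset Printing Implicit Defensive.

(** * Lebesgue measure of boxes and reflections *)

(* The weights make the statement stable under passing to a slice, so that it can be proved by
   induction on the dimension, integrating over the last coordinate. *)
Lemma weighted_box_cover_volume (R : realType) (d : nat) (a b : nat -> R)
    (A B : nat -> nat -> R) (w : nat -> R) (c : R) :
  (forall i, (i < d)%N -> (a i <= b i)%R) ->
  (forall k i, (i < d)%N -> (A k i <= B k i)%R) ->
  (forall k, (0 <= w k)%R) -> (0 <= c)%R ->
  (forall x : nat -> R, (forall i, (i < d)%N -> (a i < x i <= b i)%R) ->
     c%:E <= \sum_(k <oo) (w k * \prod_(i < d) \1_(`[A k i, B k i]) (x i))%:E) ->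
  (c * \prod_(i < d) (b i - a i))%:E <=
  \sum_(k <oo) (w k * \prod_(i < d) (B k i - A k i))%:E.
Proof.
elim: d w c => [|d IHd] w c leab leAB w0 c0 cover.
  rewrite big_ord0 mulr1; apply: le_trans (cover (fun=> 0%R) _) _ => //.
  by apply: lee_nneseries => // k _; rewrite ?big_ord0 ?mulr1 lee_fin.
rewrite big_ord_recr /=.
set P := (\prod_(i < d) (b i - a i))%R.
have P0 : (0 <= P)%R by apply: prodr_ge0 => i _; rewrite subr_ge0 leab// ltnS ltnW.
pose Q k := (\prod_(i < d) (B k i - A k i))%R.
have Q0 k : (0 <= Q k)%R by apply: prodr_ge0 => i _; rewrite subr_ge0 leAB// ltnS ltnW.
(* With the last coordinate fixed at [t], the indicator of the last edge of the [k]-th box is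
   absorbed into its weight, and the induction hypothesis applies. *)
have slice (t : R) : (a d < t <= b d)%R ->
    (c * P)%:E <= \sum_(k <oo) (w k * Q k * \1_(`[A k d, B k d]) t)%:E.
  move=> at_b.
  have := IHd (fun k => w k * \1_(`[A k d, B k d]) t)%R c.
  under [X in _ -> _ -> _ -> _ -> _ -> _ <= X]eq_eseriesr do
    rewrite -/(Q _) mulrAC.
  apply=> //.
  - by move=> i id; apply: leab; rewrite ltnS ltnW.
  - by move=> k i id; apply: leAB; rewrite ltnS ltnW.
  - by move=> k; rewrite mulr_ge0// indicE.
  - move=> x xab; have := cover (fun i => if i == d then t else x i).
    under eq_eseriesr => k _.
      rewrite big_ord_recr /= eqxx mulrCA mulrC.
      under eq_bigr => i _ do rewrite ltn_eqF//.
      over.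
    apply=> i.
    by rewrite ltnS leq_eqVlt; case: eqVneq => [->|_ /= /xab].
pose D := [set` `]a d, b d]]%R : set R.
have mD : measurable D by exact: measurable_itv.
have -> : (c * (P * (b d - a d)))%:E = \int[lebesgue_measure]_(t in D) (c * P)%:E.
  rewrite integral_cst//= /D lebesgue_measure_itv/= lte_fin mulrA.
  have [ab|] := ltP (a d) (b d); first by rewrite EFinM.
  by move=> ba; rewrite mule0 (_ : b d = a d) ?subrr ?mulr0//; apply/le_anti; rewrite ba leab.
pose f k (t : R) := (w k * Q k * \1_(`[A k d, B k d]) t)%:E.
have mf k : measurable_fun D (f k).
  by apply/measurable_EFinP/measurable_funM => //; apply/measurable_indic/measurable_itv.
have f0 k t : 0 <= f k t.
  by rewrite lee_fin !mulr_ge0// indicE.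
(* The slice bounds are integrated in [t]; sum and integral commute, and each indicator integrates
   to at most the length of its edge. *)
apply: (@le_trans _ _ (\int[lebesgue_measure]_(t in D) (\sum_(k <oo) f k t))).
  apply: ge0_le_integral => //.
  - by move=> t _; rewrite lee_fin mulr_ge0.
  - by apply: ge0_emeasurable_sum => // k _; exact: mf.
rewrite integral_nneseries//.
apply: lee_nneseries => [k _ _|k _].
  by apply: integral_ge0 => t _; exact: f0.
under eq_integral do rewrite /f EFinM.
rewrite ge0_integralZl_EFin//; last 2 first.
- by apply/measurable_EFinP; apply: measurable_indic; exact: measurable_itv.
- exact: mulr_ge0.
rewrite integral_indic//=.
rewrite big_ord_recr /= mulrA -/(Q k) [leRHS]EFinM lee_wpmul2l ?lee_fin ?mulr_ge0//.
apply: (@le_trans _ _ (lebesgue_measure `[A k d, B k d]%classic)).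
  by apply: le_measure; rewrite ?inE//; apply: measurableI.
rewrite lebesgue_measure_itv/= lte_fin; case: ifP => // _.
by rewrite lee_fin subr_ge0 leAB.
Qed.

(** Points are functions on [nat], so that the estimate serves row vectors as well as the projected
    coordinates of [hausdorff_ge_projection]. *)
Lemma box_cover_volume (R : realType) (d : nat) (a b : nat -> R)
    (A B : nat -> nat -> R) :
  (forall i, (i < d)%N -> (a i <= b i)%R) ->
  (forall k i, (i < d)%N -> (A k i <= B k i)%R) ->
  (forall x : nat -> R, (forall i, (i < d)%N -> (a i < x i <= b i)%R) ->
     exists k, forall i, (i < d)%N -> (A k i <= x i <= B k i)%R) ->
  (\prod_(i < d) (b i - a i))%:E <=
  \sum_(k <oo) (\prod_(i < d) (B k i - A k i))%:E.
Proof.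
move=> leab leAB cover.
have := @weighted_box_cover_volume R d a b A B (fun=> 1%R) 1%R leab leAB.
rewrite mul1r; under [X in _ -> _ -> _ -> _ <= X]eq_eseriesr do rewrite mul1r.
apply=> // x /cover[k xk].
have ind0 j : 0 <= (\prod_(i < d) \1_(`[A j i, B j i]) (x i) : R)%:E.
  by rewrite lee_fin prodr_ge0// => i _; rewrite indicE.
under eq_eseriesr do rewrite mul1r.
rewrite (nneseriesD1 (n := k))//.
rewrite big1 => [|i _]; last by rewrite indicE mem_set//= in_itv/= xk.
by rewrite leeDl//; apply: nneseries_ge0 => j _ _.
Qed.

Lemma eseries_head (R : realType) (f : nat -> \bar R) :
  0 <= f 0%N -> (forall k, (0 < k)%N -> f k = 0) -> \sum_(k <oo) f k = f 0%N.
Proof.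
move=> f00 f0; rewrite nneseries_recl//; last by case=> [|k] _ //; rewrite f0.
by rewrite eseries0 ?adde0// => k k0 _; rewrite f0.
Qed.

Lemma lebesgue_outer_box (R : realType) (d : nat) (ab : 'rV[R]_d.+1 * 'rV[R]_d.+1) :
  (forall i, (ab.1 ord0 i <= ab.2 ord0 i)%R) ->
  lebesgue_outer R d (box ab) = box_volume ab.
Proof.
move=> leab; apply/eqP; rewrite eq_le; apply/andP; split.
  (* Covers are infinite sequences, so the box itself is followed by degenerate boxes of volume
     zero. *)
  pose f k : 'rV[R]_d.+1 * 'rV[R]_d.+1 := if k is 0%N then ab else (0%R, 0%R).
  apply: ereal_inf_lbound; exists f; first by split=> [[|k] i|x xab] //; exists 0%N.
  rewrite eseries_head//= ?lee_fin ?prodr_ge0// => [i _|]; first by rewrite subr_ge0.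
  by case=> // k _; rewrite /box_volume /= big_ord_recl /= subrr mul0r.
apply: le_ereal_inf_tmp => _ [f [lef cov] <-].
have := @box_cover_volume R d.+1 (fun i => ab.1 ord0 (inord i))
  (fun i => ab.2 ord0 (inord i)) (fun k i => (f k).1 ord0 (inord i))
  (fun k i => (f k).2 ord0 (inord i)).
under eq_bigr do rewrite inord_val.
under [X in _ -> _ -> _ -> _ <= X]eq_eseriesr do under eq_bigr do rewrite inord_val.
apply=> // [k i _|x xab]; first exact: lef.
have /cov[k _ yk] : box ab (\row_i x i).
  by move=> i; rewrite mxE; have := xab i (ltn_ord i); rewrite inord_val.
exists k => i id; have := yk (inord i); rewrite mxE inordK// => /andP[/ltW -> ->].
by [].
Qed.

(** The hyperplane cuts every covering box into two boxes whose volumes add up, so a cover of [X]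
    splits into covers of its two parts at no cost. *)
Lemma lebesgue_halfspace (R : realType) (d : nat) (i : 'I_d.+1) (c : R) :
  caratheodory_measurable (lebesgue_outer R d) [set y : 'rV[R]_d.+1 | (y ord0 i <= c)%R].
Proof.
set H := [set y | _]; apply: le_caratheodory_measurable => X.
apply: le_ereal_inf_tmp => _ [f [/= lef cov] <-].
(* [m k] is [c] clamped to the [i]-th edge of the box: a box missed by the hyperplane yields one
   degenerate piece. *)
pose m k := Num.max ((f k).1 ord0 i) (Num.min ((f k).2 ord0 i) c).
pose upd (v : 'rV[R]_d.+1) t : 'rV[R]_d.+1 := \row_j if j == i then t else v ord0 j.
have m1 k : ((f k).1 ord0 i <= m k)%R by rewrite le_max lexx.
have m2 k : (m k <= (f k).2 ord0 i)%R by rewrite ge_max lef ge_min lexx.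
pose f1 k := ((f k).1, upd (f k).2 (m k)); pose f2 k := (upd (f k).1 (m k), (f k).2).
have lef1 k j : ((f1 k).1 ord0 j <= (f1 k).2 ord0 j)%R.
  by rewrite /= mxE; case: eqVneq => [->|_]; rewrite ?m1 ?m2 ?lef.
have lef2 k j : ((f2 k).1 ord0 j <= (f2 k).2 ord0 j)%R.
  by rewrite /= mxE; case: eqVneq => [->|_]; rewrite ?m1 ?m2 ?lef.
have vol0 (g : nat -> 'rV[R]_d.+1 * 'rV[R]_d.+1) k :
    (forall k j, ((g k).1 ord0 j <= (g k).2 ord0 j)%R) -> 0 <= box_volume (g k).
  by move=> leg; rewrite lee_fin prodr_ge0// => j _; rewrite subr_ge0.
have -> : \sum_(k <oo) box_volume (f k) =
    \sum_(k <oo) box_volume (f1 k) + \sum_(k <oo) box_volume (f2 k).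
  rewrite -nneseriesD; last 2 first.
  - by move=> k _ _; exact: (vol0 f1).
  - by move=> k _ _; exact: (vol0 f2).
  apply: eq_eseriesr => k _; rewrite /box_volume -EFinD; congr EFin.
  rewrite !(bigD1 i (P := xpredT))//= !mxE eqxx.
  have ->: (\prod_(j < d.+1 | j != i) (upd (f k).2 (m k) ord0 j - (f k).1 ord0 j) =
      \prod_(j < d.+1 | j != i) ((f k).2 ord0 j - (f k).1 ord0 j))%R.
    by apply: eq_bigr => j /negbTE ji; rewrite mxE ji.
  have ->: (\prod_(j < d.+1 | j != i) ((f k).2 ord0 j - upd (f k).1 (m k) ord0 j) =
      \prod_(j < d.+1 | j != i) ((f k).2 ord0 j - (f k).1 ord0 j))%R.
    by apply: eq_bigr => j /negbTE ji; rewrite mxE ji.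
  by rewrite -mulrDl; congr (_ * _)%R; ring.
apply: leeD; apply: ereal_inf_lbound.
  exists f1 => //; split=> // x [/cov[k _ xk] xc]; exists k => // j.
  rewrite mxE; case: eqVneq => [->|_]; last exact: xk.
  by have /andP[-> xb] := xk i; rewrite le_max le_min xb [(_ <= c)%R]xc orbT.
exists f2 => //; split=> // x [/cov[k _ xk] /negP xc]; exists k => // j.
rewrite mxE; case: eqVneq => [->|_]; last exact: xk.
have /andP[xa ->] := xk i; rewrite andbT gt_max xa gt_min.
by rewrite [(c < _)%R]ltNge xc orbT.
Qed.

Lemma ball_rVP (R : realType) (d : nat) (x y : 'rV[R]_d) (e : R) :
  ball x e y <-> (0 < e)%R /\ forall i, (`|x ord0 i - y ord0 i| < e)%R.
Proof.
split=> [[e0 xy]|[e0 xy]]; split=> // i; first exact: (xy ord0 i).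
by move=> j; rewrite ord1; exact: xy.
Qed.

(** * Caratheodory measurability of open sets *)

Section open_caratheodory.
Context (R : realType) (d : nat).
Local Notation V := 'rV[R]_d.+1.
Variable mu : {outer_measure set V -> \bar R}.
Hypothesis halfspace : forall (i : 'I_d.+1) (c : R),
  caratheodory_measurable mu [set y : V | (y ord0 i <= c)%R].
Local Notation T := (caratheodory_type mu).

Lemma measurable_coord_caratheodory (i : 'I_d.+1) :
  measurable_fun [set: T] (fun y : T => (y : V) ord0 i : R).
Proof.
apply: (measurability _ (RGenOInfty.measurableE R)) => // _ [_ [x ->] <-].
rewrite setTI -[X in measurable X]setCK; apply: measurableC.
rewrite [X in measurable X](_ : _ = [set y : V | (y ord0 i <= x)%R]); first exact: halfspace.
apply/seteqP; split=> y /=; rewrite in_itv/= andbT; first by move/negP; rewrite -leNgt.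
by move=> yx; apply/negP; rewrite -leNgt.
Qed.

(** An open set is the union of the cubes it contains that have rational centre and radius
    [1 / (m + 1)]. These are countably many, and each is a finite intersection of strips. *)
Lemma open_caratheodory (U : set V) : open U -> measurable (U : set T).
Proof.
move=> oU.
pose C (qm : 'rV[rat]_d.+1 * nat) : set V :=
  [set y | forall i, (`|y ord0 i - ratr (qm.1 ord0 i)| < qm.2.+1%:R^-1)%R].
have mC qm : measurable (C qm : set T).
  rewrite [X in measurable X](_ : _ = \bigcap_(i in [set: 'I_d.+1])
     (fun y : T => (y : V) ord0 i : R) @^-1`
        (`](ratr (qm.1 ord0 i) - qm.2.+1%:R^-1)%R, (ratr (qm.1 ord0 i) + qm.2.+1%:R^-1)%R[)); last first.
    apply/seteqP; split=> [y Cy i _|y Cy i].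
      by rewrite /= in_itv/= -ltr_distl; exact: Cy.
    by have := Cy i Logic.I; rewrite /= in_itv/= -ltr_distl.
  apply: fin_bigcap_measurable => // i _.
  rewrite -[X in measurable X]setTI; apply: measurable_coord_caratheodory => //.
have -> : U = \bigcup_(qm in [set qm | C qm `<=` U]) C qm.
  apply/seteqP; split=> [x Ux|x [qm]]; last exact.
  have /nbhs_ballP[e /= e0 xeU] := open_nbhs_nbhs (conj oU Ux).
  (* With [1 / (m + 1) < e / 2], a cube of this radius that contains [x] lies in the ball of radius
     [e]. *)
  have [m] := ltr_add_invr (divr_gt0 e0 (ltr0n R 2)); rewrite add0r => me.
  have qx i : exists q : rat, (`|x ord0 i - ratr q| < m.+1%:R^-1)%R.
    have [|q] := @rat_in_itvoo R (x ord0 i - m.+1%:R^-1)%R (x ord0 i).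
      by rewrite ltrBlDr ltrDl invr_gt0.
    rewrite in_itv/= => /andP[xq qx]; exists q.
    by rewrite ger0_norm ?subr_ge0 1?ltW// ltrBlDr addrC -ltrBlDr.
  have [q xq] := choice qx.
  exists (\row_i q i, m) => /=; last by move=> i; rewrite /= mxE.
  move=> y Cy; apply/xeU/ball_rVP; split=> // i.
  have := Cy i; rewrite /= mxE distrC => yq.
  have := ler_distD (ratr (q i)) (x ord0 i) (y ord0 i) => /le_lt_trans; apply.
  by rewrite (splitr e) ltrD// (lt_trans _ me).
rewrite bigcup_mkcond; apply: countable_bigcupT_measurable => // qm.
by case: ifP.
Qed.

Lemma continuous_caratheodory (f : V -> R) :
  continuous f -> measurable_fun [set: T] (f : T -> R).
Proof.
move=> cf; apply: (measurability _ (RGenOInfty.measurableE R)) => // _ [_ [x ->] <-].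
rewrite setTI; apply: open_caratheodory.
rewrite set_itvE; move: f cf => f /continuousP; apply; exact: open_gt.
Qed.

End open_caratheodory.

Lemma powR_gt1 (R : realType) (x a : R) : (1 < x)%R -> (0 < a)%R -> (1 < x `^ a)%R.
Proof.
move=> x1 a0; have := gt0_ltr_powR a0 _ _ x1; rewrite powR1.
by apply; rewrite nnegrE// ltW// (lt_trans ltr01).
Qed.

Section reflection.
Context (R : realType) (d : nat).
Local Notation V := 'rV[R]_d.+1.
Local Notation mu := (lebesgue_outer R d).
Implicit Types (x y : V) (X : set V).

Definition point_reflection x y : V := (x + x - y)%R.

Lemma point_reflectionK x : involutive (point_reflection x).
Proof. by move=> y; rewrite /point_reflection opprB addrC subrK. Qed.

(* A reflected box is half-open on the wrong side, and is therefore dilated by a factor [t > 1]. *)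
Let lebesgue_outer_reflection_le x X : mu (point_reflection x @^-1` X) <= mu X.
Proof.
apply: le_ereal_inf_tmp => _ [f [/= lef cov] <-].
apply/lee_mul01Pr => [|r /andP[r0 r1]]; first exact: (outer_measure_ge0 mu).
(* Dilation by [t] multiplies volumes by [1 / r], and [r < 1] is arbitrary. *)
pose t : R := (r^-1 `^ (d.+1%:R)^-1)%R.
have r'1 : (1 < r^-1)%R by rewrite invf_gt1.
have t1 : (1 < t)%R.
  by apply: powR_gt1; rewrite ?invr_gt0.
have tX : (t ^+ d.+1 = r^-1)%R.
  rewrite -powR_mulrn ?powR_ge0// /t -powRrM mulVf ?powRr1//.
  by rewrite invr_ge0 ltW.
pose c k : V := (x + x - 2^-1 *: ((f k).1 + (f k).2))%R.
pose h k : V := (2^-1 *: ((f k).2 - (f k).1))%R.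
pose g k := ((c k - t *: h k)%R, (c k + t *: h k)%R).
have h0 k i : (0 <= h k ord0 i)%R.
  by rewrite !mxE mulr_ge0// subr_ge0.
have t0 : (0 <= t)%R by rewrite ltW// (lt_trans _ t1).
have volg k : box_volume (g k) = (r^-1)%:E * box_volume (f k).
  rewrite /box_volume -EFinM; congr EFin; rewrite -tX -[X in (t ^+ X)%R](card_ord d.+1).
  rewrite -prodr_const -big_split /=; apply: eq_bigr => i _.
  by rewrite !mxE; field.
have -> : \sum_(k <oo) box_volume (f k) = \sum_(k <oo) r%:E * box_volume (g k).
  have rr : r%:E * (r^-1)%:E = 1 by rewrite -EFinM mulfV ?gt_eqF.
  by apply: eq_eseriesr => k _; rewrite volg muleA rr mul1e.
have leg k i : ((g k).1 ord0 i <= (g k).2 ord0 i)%R.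
  have := h0 k i; rewrite /= [in X in _ -> X]mxE [in X in _ -> (_ <= X)%R]mxE.
  move=> hk; rewrite lerD2l !mxE; rewrite !mxE in hk.
  by apply: (@le_trans _ _ 0%R); rewrite ?oppr_le0 mulr_ge0.
rewrite nneseriesZl; last first.
  by move=> k _; rewrite lee_fin prodr_ge0// => i _; rewrite subr_ge0; exact: leg.
apply: lee_wpmul2l; first by rewrite lee_fin ltW.
apply: ereal_inf_lbound; exists g; split=> //.
move=> y /cov[k _ yk]; exists k => // i.
have /andP[]:= yk i; rewrite !mxE; move: ((f k).1 ord0 i) ((f k).2 ord0 i) (x ord0 i) => a b z.
move=> ay yb.
have : (0 < (t - 1) * (b - a))%R by rewrite mulr_gt0// subr_gt0// (lt_le_trans ay).
by move=> tab; apply/andP; split; nra.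
Qed.

Lemma lebesgue_outer_reflection x X : mu (point_reflection x @^-1` X) = mu X.
Proof.
apply/eqP; rewrite eq_le lebesgue_outer_reflection_le/=.
apply: le_trans (lebesgue_outer_reflection_le x _).
by apply: le_outer_measure => y Xy; rewrite /preimage/= point_reflectionK.
Qed.

Lemma measurable_point_reflection x :
  measurable_fun [set: caratheodory_type mu]
    (point_reflection x : caratheodory_type mu -> caratheodory_type mu).
Proof.
move=> _ A mA; rewrite setTI.
have cA : caratheodory_measurable mu A by exact: mA.
suff : caratheodory_measurable mu (point_reflection x @^-1` A) by [].
move=> X; rewrite -(lebesgue_outer_reflection x) (cA (point_reflection x @^-1` X)).
rewrite -(lebesgue_outer_reflection x (X `&` _)) -(lebesgue_outer_reflection x (X `&` ~` _)).
by congr (mu _ + mu _); apply/seteqP; split=> y /=; rewrite /preimage/= !point_reflectionK.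
Qed.

End reflection.

Section edist.
Context (R : realType) (d : nat).
Implicit Types (x y : 'rV[R]_d) (r : R).

Lemma edist_ge0 x y : (0 <= edist x y)%R.
Proof. exact: sqrtr_ge0. Qed.

Lemma norm_coord_le_edist x y i : (`|x ord0 i - y ord0 i| <= edist x y)%R.
Proof.
rewrite -sqrtr_sqr ler_sqrt; last by apply: sumr_ge0 => j _; exact: sqr_ge0.
by rewrite (bigD1 i)//= lerDl sumr_ge0// => j _; exact: sqr_ge0.
Qed.

Lemma edist_le_norm_coord x y r : (0 <= r)%R ->
  (forall i, (`|x ord0 i - y ord0 i| <= r)%R) -> (edist x y <= d%:R * r)%R.
Proof.
move=> r0 xyr; have dr0 : (0 <= d%:R * r)%R by rewrite mulr_ge0.
rewrite -[leRHS](ger0_norm dr0) -sqrtr_sqr ler_sqrt ?sqr_ge0//.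
apply: (@le_trans _ _ (\sum_(i < d) r ^+ 2)%R).
  by apply: ler_sum => i _; rewrite -[leLHS]real_normK ?num_real// ler_pXn2r// nnegrE.
rewrite sumr_const card_ord -[leLHS]mulr_natl exprMn; apply: ler_wpM2r; first exact: sqr_ge0.
by rewrite -natrX ler_nat; case: (d) => // k; rewrite -mulnn leq_pmulr.
Qed.

Lemma continuous_edist x : continuous (fun y => edist y x).
Proof.
move=> y; apply: continuous_comp; last exact: sqrt_continuous.
move: y; apply: continuous_big => [|i _]; first exact: add_continuous.
move=> y; apply: (@continuous_comp _ _ _ (fun y : 'rV[R]_d => y ord0 i - x ord0 i)%R
  (fun t => t ^+ 2)%R); last exact: exprn_continuous.
by apply: continuousB; [exact: coord_continuous|exact: cst_continuous].
Qed.

End edist.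

Lemma edist_point_reflection (R : realType) (d : nat) (x y : 'rV[R]_d.+1) :
  edist (point_reflection x y) x = edist y x.
Proof.
congr Num.sqrt; apply: eq_bigr => i _; rewrite !mxE -sqrrN; congr (_ ^+ 2)%R; ring.
Qed.

(** * The principal value *)

Section principal_value.
Context (R : realType) (d : nat).
Local Notation V := 'rV[R]_d.+1.
Local Notation mu := (lebesgue_rV R d).
Local Notation T := (caratheodory_type (lebesgue_outer R d)).

Lemma lebesgue_open (U : set V) : open U -> measurable (U : set T).
Proof. by apply: open_caratheodory; exact: lebesgue_halfspace. Qed.

Lemma lebesgue_continuous (f : V -> R) : continuous f -> measurable_fun [set: T] (f : T -> R).
Proof. by apply: continuous_caratheodory; exact: lebesgue_halfspace. Qed.

Definition cube (x : V) (r : R) : set V :=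
  box ((x - const_mx r)%R, (x + const_mx r)%R).

Lemma cubeP x r y : cube x r y <-> forall i, (- r < y ord0 i - x ord0 i <= r)%R.
Proof.
by split=> xy i; have := xy i; rewrite /= !mxE => /andP[xy1 xy2]; apply/andP; split; lra.
Qed.

Lemma lebesgue_cube x r : (0 <= r)%R -> mu (cube x r) = ((2 * r) ^+ d.+1)%:E.
Proof.
move=> r0; transitivity (box_volume ((x - const_mx r)%R, (x + const_mx r)%R)).
  by apply: lebesgue_outer_box => i; rewrite /= !mxE; lra.
rewrite /box_volume; congr EFin; rewrite -[X in (_ ^+ X)%R](card_ord d.+1) -prodr_const.
by apply: eq_bigr => i _; rewrite /= !mxE; ring.
Qed.

Lemma measurable_cube x r : measurable (cube x r : set T).
Proof.
rewrite [X in measurable X](_ : _ = \bigcap_(i in [set: 'I_d.+1])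
   (fun y : T => (y : V) ord0 i : R) @^-1`
      (`](x ord0 i - r)%R, (x ord0 i + r)%R])); last first.
  by apply/seteqP; split=> [y Cy i _|y Cy i];
    [have := Cy i|have := Cy i Logic.I]; rewrite /= in_itv/= !mxE.
apply: fin_bigcap_measurable => // i _; rewrite -[X in measurable X]setTI.
by apply: measurable_coord_caratheodory => // j c; exact: lebesgue_halfspace.
Qed.

Definition riesz_kernel (b : R) (x y : V) : R := (edist y x `^ (- b))%R.

Lemma riesz_kernel_ge0 b x y : (0 <= riesz_kernel b x y)%R.
Proof. exact: powR_ge0. Qed.

Lemma measurable_riesz_kernel b x :
  measurable_fun [set: T] (fun y : T => (riesz_kernel b x y)%:E).
Proof.
apply/measurable_EFinP.
apply: (@measurableT_comp _ _ _ _ _ _ (fun t : R => t `^ (- b))%R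
  [set: T] (fun y : T => edist (y : V) x)); first exact: measurable_powR.
exact/lebesgue_continuous/continuous_edist.
Qed.

Lemma measurable_edist_ge (x : V) (e : R) : measurable ([set y | e <= edist y x]%R : set T).
Proof.
have := lebesgue_continuous (@continuous_edist R d.+1 x) measurableT
  (measurable_itv `[e, +oo[).
by rewrite setTI set_itvE.
Qed.

(** On the dyadic shell from [rho j] to [rho j.+1] the kernel is at most [rho j ^ (- b)], and the
    shell lies in a cube of side [4 * rho j]. The contributions form a geometric series of ratio
    [2 ^ (- a)]. *)
Lemma integral_riesz_kernel_lty (a e : R) (x : V) : (0 < a)%R -> (0 < e)%R ->
  \int[mu]_(y in [set y | (e <= edist y x)%R]) (riesz_kernel (d.+1%:R + a) x y)%:E < +oo.
Proof.
move=> a0 e0; set D := [set y | _]; set b := (d.+1%:R + a)%R.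
have b0 : (0 < b)%R by rewrite addr_gt0.
pose rho j : R := (2 ^+ j * e)%R.
have rho0 j : (0 < rho j)%R by rewrite mulr_gt0// exprn_gt0.
pose f j (y : T) := (rho j `^ (- b) * \1_(cube x (rho j.+1)) y)%:E.
have f0 j y : 0 <= f j y by rewrite lee_fin mulr_ge0 ?powR_ge0// indicE.
have mf j : measurable_fun [set: T] (f j).
  apply/measurable_EFinP/measurable_funM; first exact: measurable_cst.
  by apply: measurable_indic; exact: measurable_cube.
have mD : measurable (D : set T) by exact: measurable_edist_ge.
have kf (y : V) : D y -> (riesz_kernel b x y)%:E <= \sum_(j <oo) f j y.
  move=> ey.
  have [j /andP[yj1 yj2]] : exists j, (rho j <= edist y x < rho j.+1)%R.
    have ex : exists j, (edist y x < rho j)%R.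
      exists (Num.bound (edist y x / e)); rewrite -ltr_pdivrMr//.
      apply: lt_le_trans (archi_boundP _) _; first by rewrite divr_ge0 ?edist_ge0// ltW.
      by rewrite -natrX ler_nat ltnW// ltn_expl.
    case: (ex_minnP ex) => -[|j] yj minj.
      by move: yj; rewrite /rho expr0 mul1r ltNge ey.
    exists j; rewrite yj andbT leNgt; apply/negP => /minj.
    by rewrite ltnn.
  rewrite (nneseriesD1 (n := j))//; apply: (@le_trans _ _ (f j y)); last first.
    by rewrite leeDl//; apply: nneseries_ge0 => k _ _.
  rewrite lee_fin indicE mem_set ?mulr1; last first.
    apply/cubeP => i; have := le_lt_trans (norm_coord_le_edist y x i) yj2.
    by rewrite ltr_norml => /andP[-> /ltW].
  rewrite /riesz_kernel !powRN lef_pV2 ?posrE ?powR_gt0//; last exact: lt_le_trans yj1.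
  by apply: ge0_ler_powR; rewrite ?nnegrE ?edist_ge0//; exact: ltW.
apply: (@le_lt_trans _ _ (\int[mu]_(y in D) (\sum_(j <oo) f j y))).
  apply: ge0_le_integral; [exact: mD| | | |exact: kf].
  - by move=> y _; rewrite lee_fin riesz_kernel_ge0.
  - by apply: measurable_funTS; exact: measurable_riesz_kernel.
  - by apply: ge0_emeasurable_sum => // k _; exact: measurable_funTS.
rewrite integral_nneseries//; last by move=> j; exact: measurable_funTS.
pose q : R := (2 `^ (- a))%R.
have bound j : \int[mu]_(y in D) f j y <= (4 ^+ d.+1 * e `^ (- a) * q ^+ j)%:E.
  under eq_integral do rewrite /f EFinM.
  rewrite (ge0_integralZl_EFin _ mD); [|by move=> y _; rewrite lee_fin indicE| |exact: powR_ge0]; last first.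
    by apply/measurable_EFinP/measurable_indic; exact: measurable_cube.
  rewrite integral_indic//=; last exact: measurable_cube.
  apply: (@le_trans _ _ ((rho j `^ (- b))%:E * mu (cube x (rho j.+1)))).
    apply: lee_wpmul2l; first by rewrite lee_fin powR_ge0.
    apply: le_measure; rewrite ?inE; [|exact: measurable_cube|exact: subIsetl].
    by apply: measurableI => //; exact: measurable_cube.
  rewrite lebesgue_cube; last exact: ltW.
  rewrite -[leLHS]EFinM lee_fin /b opprD powRD; last by rewrite (gt_eqF (rho0 j)) implybT.
  rewrite (powR_invn _ (ltW (rho0 j))) (_ : 2 * rho j.+1 = 4 * rho j)%R; last first.
    by rewrite /rho exprS; ring.
  have rhoj : (rho j `^ (- a) = e `^ (- a) * q ^+ j)%R.
    rewrite /rho powRM ?exprn_ge0 ?ltW// mulrC; congr (_ * _)%R.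
    by rewrite -powR_mulrn// -powRrM mulrC powRrM powR_mulrn ?powR_ge0.
  rewrite rhoj (exprMn d.+1 4 (rho j))%R.
  have : (rho j ^+ d.+1 != 0)%R by rewrite expf_neq0// gt_eqF.
  move: (rho j ^+ d.+1)%R (4 ^+ d.+1)%R (e `^ (- a))%R (q ^+ j)%R => A B C E A0.
  by rewrite le_eqVlt; apply/orP; left; apply/eqP; field.
have q0 : (0 < q)%R by rewrite powR_gt0.
have q1 : (`|q| < 1)%R.
  rewrite gtr0_norm// /q powRN invf_lt1 ?powR_gt0//.
  by apply: powR_gt1; rewrite ?ltr1n.
pose c : R := (4 ^+ d.+1 * e `^ (- a))%R.
have c0 : (0 <= c)%R by rewrite mulr_ge0 ?powR_ge0// exprn_ge0.
apply: (@le_lt_trans _ _ (c / (1 - q))%:E); last exact: ltry.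
apply: lime_le.
  by apply: is_cvg_nneseries => j _ _; apply: integral_ge0 => y _.
near=> N.
apply: le_trans (_ : ((series (geometric c q) N)%:E <= _)); last first.
  by rewrite lee_fin; exact: geometric_le_lim.
rewrite /series /geometric /= -sumEFin; apply: lee_sum => j _; exact: bound.
Unshelve. all: by end_near. Qed.

Lemma integral_point_reflection (x : V) (D : set V) (f : V -> \bar R) :
  measurable (D : set T) -> measurable_fun [set: T] (f : T -> \bar R) ->
  (forall y, 0 <= f y) -> (forall y, f (point_reflection x y) = f y) ->
  \int[mu]_(y in D) f y = \int[mu]_(y in point_reflection x @^-1` D) f y.
Proof.
move=> mD mf f0 fx.
have -> : \int[mu]_(y in point_reflection x @^-1` D) f y =
    \int[mu]_(y in point_reflection x @^-1` D) (f \o point_reflection x) y.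
  by apply: eq_integral => y _; exact/esym/fx.
rewrite -(ge0_integral_pushforward (measurable_point_reflection x) mu mD (measurable_funTS mf) (fun y _ => f0 y)).
set nu := (X in _ = \int[X]_(_ in _) _).
apply: (eq_measure_integral nu); first exact: measurable_point_reflection.
by move=> mphi A mA _; exact: esym (lebesgue_outer_reflection x A).
Qed.

Definition reflected_exterior (Omega : set V) (x : V) : set V :=
  [set y | ~ Omega y /\ ~ Omega (point_reflection x y)].

Lemma measurable_reflected_exterior (Omega : set V) (x : V) :
  open Omega -> measurable (reflected_exterior Omega x : set T).
Proof.
move=> /lebesgue_open mO.
rewrite (_ : reflected_exterior _ _ = ~` Omega `&` ~` (point_reflection x @^-1` Omega)); last first.
  by apply/seteqP; split.
apply: measurableI; first exact: measurableC.
by apply: measurableC; rewrite -[X in measurable X]setTI; apply: measurable_point_reflection.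
Qed.

(* Since [Omega] is disjoint from its reflection, the two contribute opposite amounts. *)
Lemma truncated_curvature_integral (b e : R) (Omega : set V) (x : V) :
  (d.+1%:R < b)%R -> (0 < e)%R -> open Omega ->
  (forall y, Omega y -> ~ Omega (point_reflection x y)) ->
  \int[mu]_(y in [set y | (e <= edist y x)%R])
     ((\1_(~` Omega) y - \1_Omega y) / (edist y x `^ b))%:E =
  \int[mu]_(y in [set y | (e <= edist y x)%R] `&` reflected_exterior Omega x)
     (riesz_kernel b x y)%:E.
Proof.
move=> b0 e0 oO asym; set D := [set y | (e <= _)%R].
have mD : measurable (D : set T) by exact: measurable_edist_ge.
have mO : measurable (Omega : set T) by exact: lebesgue_open.
pose K y := (riesz_kernel b x y)%:E.
have mK : measurable_fun [set: T] (K : T -> \bar R) by exact: measurable_riesz_kernel.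
have K0 y : 0 <= K y by rewrite lee_fin riesz_kernel_ge0.
have Kx y : K (point_reflection x y) = K y.
  by rewrite /K /riesz_kernel edist_point_reflection.
pose OR : set V := point_reflection x @^-1` Omega.
have mOR : measurable (OR : set T).
  by rewrite -[X in measurable X]setTI; apply: measurable_point_reflection.
have DR : point_reflection x @^-1` D = D.
  by apply/seteqP; split=> y; rewrite /D /preimage/= edist_point_reflection.
rewrite integralE.
have -> : \int[mu]_(y in D) ((fun y => ((\1_(~` Omega) y - \1_Omega y) / edist y x `^ b)%:E)^\+ y)
    = \int[mu]_(y in D `&` ~` Omega) K y.
  rewrite integral_mkcondr; apply: eq_integral => y _.
  rewrite funeposE patchE /K /riesz_kernel powRN !indicE !in_setC.
  case: (y \in Omega) => /=; last by rewrite subr0 mul1r; apply/max_idPl; rewrite lee_fin invr_ge0 powR_ge0.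
  by rewrite sub0r mulN1r; apply/max_idPr; rewrite lee_fin oppr_le0 invr_ge0 powR_ge0.
have -> : \int[mu]_(y in D) ((fun y => ((\1_(~` Omega) y - \1_Omega y) / edist y x `^ b)%:E)^\- y)
    = \int[mu]_(y in D `&` Omega) K y.
  rewrite integral_mkcondr; apply: eq_integral => y _.
  rewrite funenegE patchE /K /riesz_kernel powRN !indicE !in_setC -EFinN.
  case: (y \in Omega) => /=; first by rewrite sub0r mulN1r opprK; apply/max_idPl; rewrite lee_fin invr_ge0 powR_ge0.
  by rewrite subr0 mul1r; apply/max_idPr; rewrite lee_fin oppr_le0 invr_ge0 powR_ge0.
have -> : \int[mu]_(y in D `&` Omega) K y = \int[mu]_(y in D `&` OR) K y.
  rewrite (integral_point_reflection (x := x))//; last exact: measurableI.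
  by rewrite preimage_setI DR.
have -> : D `&` ~` Omega = (D `&` OR) `|` (D `&` reflected_exterior Omega x).
  apply/seteqP; split=> [y [Dy nOy]|y [[Dy Oy]|[Dy [nOy _]]]]; [|split=> // Oy'; exact: (asym y)|by []].
  by have [|] := pselect (OR y); [left|right].
have mZ : measurable (reflected_exterior Omega x : set T) by exact: measurable_reflected_exterior.
rewrite ge0_integral_setU//=; last 4 first.
- exact: measurableI.
- exact: measurableI.
- exact: measurable_funTS.
- by apply/disj_setPS => y [[_ Oy] [_ [_]]].
(* The common part can be cancelled because it is finite away from the singularity. *)
have fin : \int[mu]_(y in D `&` OR) K y \is a fin_num.
  rewrite ge0_fin_numE; last exact: integral_ge0.
  apply: le_lt_trans (integral_riesz_kernel_lty x (a := (b - d.+1%:R)%R) _ e0).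
    rewrite subrKC; apply: ge0_subset_integral => //.
    - exact: measurableI.
    - exact: measurable_funTS.
  by rewrite subr_gt0.
by rewrite addeAC subee// add0e.
Qed.

(** The truncated integrals increase as the truncation radius decreases to zero, so their limit is
    their supremum and dominates each of them. *)
Lemma curvature_ge_integral (a e : R) (Omega : set V) (x : V) :
  (0 < a)%R -> (0 < e)%R -> open Omega ->
  (forall y, Omega y -> ~ Omega (point_reflection x y)) ->
  (a / 2)%:E * \int[mu]_(y in [set y | (e <= edist y x)%R] `&` reflected_exterior Omega x)
     (riesz_kernel (d.+1%:R + a) x y)%:E <=
  nonlocal_mean_curvature a Omega x.
Proof.
move=> a0 e0 oO asym; apply: lee_wpmul2l; first by rewrite lee_fin divr_ge0 ?ltW.
set Z := reflected_exterior Omega x; set b := (d.+1%:R + a)%R.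
pose G e := \int[mu]_(y in [set y | (e <= edist y x)%R] `&` Z) (riesz_kernel b x y)%:E.
have mZ : measurable (Z : set T) by exact: measurable_reflected_exterior.
have mSZ t : measurable ([set y | (t <= edist y x)%R] `&` Z : set T).
  by apply: measurableI => //; exact: measurable_edist_ge.
have Gle : {in `]0%R, +oo[ &, {homo G : s t / (s <= t)%R >-> t <= s}}.
  move=> s t _ _ st; apply: ge0_subset_integral; [exact: mSZ|exact: mSZ| | |].
  - exact: measurable_funTS (measurable_riesz_kernel _ _).
  - by move=> y _; rewrite lee_fin riesz_kernel_ge0.
  - by move=> y [/= ty Zy]; split=> //=; exact: le_trans ty.
have Gcvg := @nonincreasing_at_right_cvge _ G 0%R +oo%O isT Gle.
rewrite (_ : lim _ = ereal_sup [set G t | t in `]0%R, +oo[]); last first.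
  apply/cvg_lim => //; apply: cvg_trans Gcvg; apply: near_eq_cvg; near=> t.
  have t0 : (0 < t)%R by near: t; exact: nbhs_right_gt.
  by apply/esym/truncated_curvature_integral => //; rewrite ltrDl.
by apply: ereal_sup_ubound; exists e => //=; rewrite in_itv/= e0.
Unshelve. all: by end_near. Qed.

Lemma curvature_ge_cube (a e rho eta : R) (Omega : set V) (x p : V) :
  (0 < a)%R -> (0 < e)%R -> (0 <= eta)%R -> open Omega ->
  (forall y, Omega y -> ~ Omega (point_reflection x y)) ->
  cube p eta `<=` reflected_exterior Omega x ->
  (forall y, cube p eta y -> (e <= edist y x <= rho)%R) ->
  (a / 2 * (rho `^ (- (d.+1%:R + a)) * (2 * eta) ^+ d.+1))%:E <=
  nonlocal_mean_curvature a Omega x.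
Proof.
move=> a0 e0 eta0 oO asym pZ perho.
apply: le_trans (curvature_ge_integral a0 e0 oO asym).
rewrite EFinM; apply: lee_wpmul2l; first by rewrite lee_fin divr_ge0 ?ltW.
set b := (d.+1%:R + a)%R.
have mk (D : set V) : measurable_fun (D : set T) (fun y : T => (riesz_kernel b x y)%:E).
  exact: measurable_funTS (measurable_riesz_kernel _ _).
have k0 y : 0 <= (riesz_kernel b x y)%:E by rewrite lee_fin riesz_kernel_ge0.
have mZ : measurable (reflected_exterior Omega x : set T) by exact: measurable_reflected_exterior.
apply: (@le_trans _ _ (\int[mu]_(y in cube p eta) (riesz_kernel b x y)%:E)); last first.
  apply: ge0_subset_integral.
  - exact: measurable_cube.
  - by apply: measurableI => //; exact: measurable_edist_ge.
  - exact: mk.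
  - by move=> y _; exact: k0.
  - by move=> y py; split; [have /andP[] := perho y py|exact: pZ].
apply: (@le_trans _ _ (\int[mu]_(y in cube p eta) (rho `^ (- b))%:E)).
  by rewrite integral_cst ?lebesgue_cube// ?EFinM//; exact: measurable_cube.
apply: ge0_le_integral.
- exact: measurable_cube.
- by move=> y _; rewrite lee_fin powR_ge0.
- exact: measurable_cst.
- exact: mk.
move=> y /perho /andP[ey yrho].
have y0 : (0 < edist y x)%R by exact: lt_le_trans ey.
rewrite lee_fin /riesz_kernel !powRN lef_pV2 ?posrE ?powR_gt0//; last exact: lt_le_trans yrho.
apply: ge0_ler_powR; rewrite ?nnegrE ?edist_ge0//; first by rewrite addr_ge0// ltW.
by rewrite (le_trans _ yrho)// edist_ge0.
Qed.

End principal_value.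

(** * Hausdorff measure *)

(* Caratheodory's criterion: the rings [R_ k] have finite total measure since the even ones, and the
   odd ones, are mutually separated. *)
Lemma caratheodory_sublevel (R : realType) (T : Type)
    (mu : {outer_measure set T -> \bar R}) (g : T -> R) :
  (forall A B (c e : R), (0 < e)%R -> (forall x, A x -> g x <= c)%R ->
     (forall x, B x -> c + e <= g x)%R -> mu A + mu B <= mu (A `|` B)) ->
  forall c, caratheodory_measurable mu [set x | (g x <= c)%R].
Proof.
move=> sep c; apply: le_caratheodory_measurable => X.
set A := X `&` _; set B := X `&` _.
have [->|Xoo] := eqVneq (mu X) +oo; first by rewrite leey.
have mu0 Y : 0 <= mu Y by exact: outer_measure_ge0.
have Xfin : mu X \is a fin_num by rewrite ge0_fin_numE// ltey.
pose t k : R := (k.+1%:R^-1)%R.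
have tS k : (t k.+1 < t k)%R by rewrite /t ltf_pV2 ?posrE// ltr_nat.
pose B_ k := X `&` [set x | (c + t k <= g x)%R].
pose R_ k := X `&` [set x | (c + t k.+1 <= g x < c + t k)%R].
pose U p N := \big[setU/set0]_(i < N) R_ (i.*2 + p)%N.
have sumU p N : \sum_(i < N) mu (R_ (i.*2 + p)%N) <= mu (U p N) /\
    (forall x, U p N x -> X x /\ exists2 j, (j < N)%N & c + t (j.*2 + p).+1 <= g x)%R.
  elim: N => [|N [IH1 IH2]]; first by rewrite /U !big_ord0 outer_measure0.
  rewrite /U !big_ord_recr /= -/(U p N); split; last first.
    move=> x [/IH2[Xx [j jN gx]]|[Xx /andP[gx _]]]; split=> //.
      by exists j => //; rewrite ltnW.
    by exists N.
  apply: (@le_trans _ _ (mu (U p N) + mu (R_ (N.*2 + p)%N))); first exact: leeD.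
  rewrite addeC setUC; case: N => [|N] in IH1 IH2 *.
    by rewrite /U big_ord0 outer_measure0 adde0 setU0.
  (* The gap between the new ring and the earlier ones of the same parity is the width of the ring
     of the other parity lying between. *)
  apply: (sep _ _ (c + t (N.+1.*2 + p)) (t (N.*2 + p).+1 - t (N.+1.*2 + p)))%R.
  - by rewrite subr_gt0; exact: (tS (N.*2 + p).+1).
  - by move=> x [_ /andP[_ /ltW]].
  - move=> x /IH2[_ [j jN]]; apply: le_trans; rewrite -addrA subrKC lerD2l.
    rewrite /t lef_pV2 ?posrE// ler_nat !ltnS leq_add2r leq_double; exact: jN.
have sumR N : \sum_(0 <= i < N) mu (R_ i) <= mu X + mu X.
  apply: (@le_trans _ _ (\sum_(0 <= i < N.*2) mu (R_ i))).
    by apply: lee_sum_nneg_natr => //; rewrite -addnn leq_addr.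
  have -> : \sum_(0 <= i < N.*2) mu (R_ i) =
      \sum_(i < N) mu (R_ (i.*2 + 0)%N) + \sum_(i < N) mu (R_ (i.*2 + 1)%N).
    elim: N => [|N IH]; first by rewrite !big_ord0 adde0 big_nil.
    rewrite doubleS !big_nat_recr//= IH !big_ord_recr/= addn0 addn1.
    by rewrite -!addeA; congr (_ + _); rewrite addeCA.
  have UX p : U p N `<=` X by move=> x /(sumU p N).2[].
  by apply: leeD; apply: le_trans (sumU _ _).1 _; exact: le_outer_measure.
have Rfin : \sum_(i <oo) mu (R_ i) < +oo.
  apply: (@le_lt_trans _ _ (mu X + mu X)); last by rewrite -ge0_fin_numE ?adde_ge0// fin_numD Xfin.
  by apply: lime_le; [exact: is_cvg_nneseries|near=> N; exact: sumR].
(* [A] and [B_ k] are separated by [t k], and [B] exceeds [B_ k] only by the rings from [k] on,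
   whose measures form the tail of a convergent series. *)
have tail k : mu A + mu B <= mu X + \sum_(k <= i <oo) mu (R_ i).
  have BB : mu B <= mu (B_ k) + \sum_(k <= i <oo) mu (R_ i).
    apply: (@le_trans _ _ (mu (B_ k `|` \bigcup_(i in ~` `I_k) R_ i))); last first.
      apply: (le_trans (outer_measureU2 _ _ _)); apply: leeD => //.
      exact: outer_measure_sigma_subadditive_tail.
    apply: le_outer_measure => x [Xx /negP]; rewrite /= -ltNge => cx.
    have [kx|xk] := leP (c + t k)%R (g x); [by left|right].
    have [m /ltW mx] := ltr_add_invr cx.
    have ex : exists m, (c + t m <= g x)%R by exists m.
    case: (ex_minnP ex) => -[|j] jx minj.
      by have := le_lt_trans jx xk; rewrite ltrD2l ltf_pV2 ?posrE// ltr_nat ltnS.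
    exists j.
      move=> /= jk; have := le_lt_trans jx xk.
      by rewrite ltrD2l ltf_pV2 ?posrE// ltr_nat !ltnS leqNgt jk.
    split=> //=; rewrite jx/= ltNge; apply/negP => /minj.
    by rewrite ltnn.
  apply: (le_trans (leeD (lexx _) BB)); rewrite addeA leeD//.
  apply: le_trans (_ : mu (A `|` B_ k) <= _).
    by apply: (sep _ _ c (t k)) => [|x [_]|x [_]]//; rewrite /t invr_gt0.
  by apply: le_outer_measure => x [[]|[]].
rewrite -[leRHS]adde0.
have cv : (fun k => mu X + \sum_(k <= i <oo) mu (R_ i)) @ \oo --> mu X + 0.
  apply: cvgeD; [by rewrite fin_num_adde_defr|exact: cvg_cst|].
  exact: nneseries_tail_cvg.
rewrite -(cvg_lim _ cv)//; apply: lime_ge; first by apply/cvg_ex; eexists; exact: cv.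
by near=> k; exact: tail.
Unshelve. all: by end_near. Qed.

Section hausdorff_measurable.
Context (R : realType) (d k : nat).
Local Notation V := 'rV[R]_d.
Implicit Types (A B U : set V).

Lemma edist_le_ediameter U x y : U x -> U y -> (edist x y)%:E <= ediameter U.
Proof. by move=> Ux Uy; apply: ereal_sup_ubound; exists (x, y). Qed.

Lemma hausdorff_gauge_ge0 U : 0 <= hausdorff_gauge k U.
Proof.
rewrite /hausdorff_gauge; case: eqVneq => // /set0P[x Ux].
rewrite mule_ge0 ?lee_fin ?ball_volume_ge0// expe_ge0// mule_ge0//.
by apply: le_trans (edist_le_ediameter Ux Ux); rewrite lee_fin edist_ge0.
Qed.

Lemma hausdorff_pre_le (e e' : R) A : (e <= e')%R ->
  hausdorff_pre k e' A <= hausdorff_pre k e A.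
Proof.
move=> ee'; apply: ereal_inf_le_tmp => _ [f [fe cov] <-]; exists f => //; split=> // j.
by apply: le_trans (fe j) _; rewrite lee_fin.
Qed.

(** A set of diameter at most [e < eta] cannot meet both [A] and [B], so a cover of the union
    splits. In [meet] the sets that miss the target become [set0], whose gauge is zero. *)
Lemma hausdorff_pre_separated (e eta : R) A B : (e < eta)%R ->
  (forall x y, A x -> B y -> eta <= edist x y)%R ->
  hausdorff_pre k e A + hausdorff_pre k e B <= hausdorff_pre k e (A `|` B).
Proof.
move=> e_eta sep; apply: le_ereal_inf_tmp => _ [f [fe cov] <-].
pose meet A j := if `[< f j `&` A !=set0 >] then f j else set0.
have meet_le C j : ediameter (meet C j) <= e%:E.
  rewrite /meet; case: ifP => _; first exact: fe.
  by rewrite /ediameter set0X image_set0 ereal_sup0 leNye.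
have cov_meet C : C `<=` A `|` B -> hausdorff_pre k e C <= \sum_(j <oo) hausdorff_gauge k (meet C j).
  move=> CAB; apply: ereal_inf_lbound; exists (meet C) => //; split=> [j|x Cx]; first exact: meet_le.
  have [j _ fx] := cov _ (CAB _ Cx); exists j => //=; rewrite /meet.
  by case: ifPn => // /asboolP; case; exists x.
apply: le_trans (leeD (cov_meet A _) (cov_meet B _)) _ => [x|x|]; [by left|by right|].
rewrite -nneseriesD; [|by move=> j _ _; exact: hausdorff_gauge_ge0..].
apply: lee_nneseries => [j _ _|j _]; first by rewrite adde_ge0// hausdorff_gauge_ge0.
have g0 : hausdorff_gauge k (set0 : set V) = 0 by rewrite /hausdorff_gauge eqxx.
rewrite /meet; case: ifPn => [/asboolP[x [fx Ax]]|_]; last first.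
  by case: ifP => _; rewrite g0 ?add0e// hausdorff_gauge_ge0.
case: ifPn => [/asboolP[y [fy By]]|_]; last by rewrite g0 adde0.
have := le_trans (edist_le_ediameter fx fy) (fe j).
by rewrite lee_fin leNgt (lt_le_trans e_eta (sep _ _ Ax By)).
Qed.

(** The two suprema on the left run over independent scales [e1] and [e2]. Premeasures grow as the
    scale shrinks, so a common scale below [e1], [e2] and [eta] bounds both terms at once; the
    suprema are then taken one after the other. *)
Lemma hausdorff_separated (eta : R) A B : (0 < eta)%R ->
  (forall x y, A x -> B y -> eta <= edist x y)%R ->
  hausdorff_outer R d k A + hausdorff_outer R d k B <= hausdorff_outer R d k (A `|` B).
Proof.
move=> eta0 sep; set S := hausdorff_outer R d k (A `|` B).
have pre0 e (C : set V) : 0 <= hausdorff_pre k e C.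
  by apply: cover_outer_ge0 => U _; exact: hausdorff_gauge_ge0.
have key e1 e2 : (0 < e1)%R -> (0 < e2)%R -> hausdorff_pre k e1 A + hausdorff_pre k e2 B <= S.
  move=> e10 e20; pose e := Num.min (Num.min e1 e2) (eta / 2)%R.
  have e0 : (0 < e)%R by rewrite !lt_min e10 e20 divr_gt0.
  apply: (@le_trans _ _ (hausdorff_pre k e (A `|` B))); last first.
    by apply: ereal_sup_ubound; exists e.
  apply: le_trans (hausdorff_pre_separated _ sep); last first.
    by rewrite /e gt_min; apply/orP; right; rewrite ltr_pdivrMr// ltr_pMr// ltr1n.
  by apply: leeD; apply: hausdorff_pre_le; rewrite !ge_min lexx ?orbT.
have [->|Soo] := eqVneq S +oo; first by rewrite leey.
have Sfin : S \is a fin_num.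
  by rewrite ge0_fin_numE ?ltey//; exact: outer_measure_ge0.
have prefin (C : set V) e : (0 < e)%R -> hausdorff_pre k e C <= S -> hausdorff_pre k e C \is a fin_num.
  by move=> e0 CS; rewrite ge0_fin_numE ?pre0// (le_lt_trans CS) ?ltey.
have HA e2 : (0 < e2)%R -> hausdorff_outer R d k A <= S - hausdorff_pre k e2 B.
  move=> e20; apply: ge_ereal_sup => _ [e1 e10 <-].
  rewrite leeBrDr; first exact: key.
  apply: prefin => //; apply: le_trans (key _ _ e20 e20).
  by rewrite leeDr.
have HAfin : hausdorff_outer R d k A \is a fin_num.
  rewrite ge0_fin_numE; last exact: outer_measure_ge0.
  apply: le_lt_trans (HA 1%R ltr01) _; apply: (@le_lt_trans _ _ S); last by rewrite ltey.
  by rewrite leeBlDr ?leeDl//; apply: prefin => //; apply: le_trans (key _ _ ltr01 ltr01); rewrite leeDr.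
rewrite addeC -leeBrDr//; apply: ge_ereal_sup => _ [e2 e20 <-].
rewrite leeBrDr// addeC -leeBrDr; first exact: HA.
by apply: prefin => //; apply: le_trans (key _ _ e20 e20); rewrite leeDr.
Qed.

End hausdorff_measurable.

Lemma hausdorff_halfspace (R : realType) (d k : nat) (i : 'I_d.+1) (c : R) :
  caratheodory_measurable (hausdorff_outer R d.+1 k) [set y : 'rV[R]_d.+1 | (y ord0 i <= c)%R].
Proof.
apply: (@caratheodory_sublevel _ _ _ (fun y : 'rV[R]_d.+1 => y ord0 i)) => A B {}c e e0 Ac Be.
apply: hausdorff_separated e0 _ => x y Ax By.
apply: le_trans (norm_coord_le_edist x y i); rewrite distrC.
apply: le_trans (ler_norm _); have := Ac _ Ax; have := Be _ By; lra.
Qed.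

Lemma hausdorff_open (R : realType) (d k : nat) (U : set 'rV[R]_d.+1) :
  open U -> measurable (U : set (caratheodory_type (hausdorff_outer R d.+1 k))).
Proof. by apply: open_caratheodory; exact: hausdorff_halfspace. Qed.

(** A covering set of diameter [D] projects into a closed cube of side [2 L D]. These cubes cover a
    cube of side [rho], so their volumes sum to at least [rho ^ k]; the factor [4 L] compares the
    side [2 L D] with the radius [D / 2] of the gauge. *)
Lemma hausdorff_ge_projection (R : realType) (d k : nat) (S : set 'rV[R]_d)
    (P : 'rV[R]_d -> nat -> R) (L rho : R) (a : nat -> R) :
  (0 < k)%N -> (0 < L)%R -> (0 <= rho)%R ->
  (forall x y i, `|P x i - P y i| <= L * edist x y)%R ->
  (forall w : nat -> R, (forall i, (i < k)%N -> a i < w i <= a i + rho)%R ->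
     exists2 x, S x & forall i, (i < k)%N -> P x i = w i) ->
  (ball_volume R k * (rho / (4 * L)) ^+ k)%:E <= hausdorff_outer R d k S.
Proof.
move=> k0 L0 rho0 Plip surj.
(* Scale [1] suffices for a lower bound on the supremum, and it makes all diameters finite. *)
apply: (@le_trans _ _ (hausdorff_pre k 1 S)); last by apply: ereal_sup_ubound; exists 1%R => /=.
apply: le_ereal_inf_tmp => _ [f [/= f1 cov] <-].
pose y j : 'rV[R]_d := xget 0%R (f j).
(* An empty covering set gets [D j = 0]; as [k] is positive, its gauge and the volume of its cube
   both vanish. *)
pose D j : R := if f j == set0 then 0%R else fine (ediameter (f j)).
have Dle j x z : f j x -> f j z -> (edist x z <= D j)%R.
  move=> fx fz; have xz := edist_le_ediameter fx fz; rewrite /D; case: eqVneq => [f0|_].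
    by move: fx; rewrite f0.
  rewrite -lee_fin fineK// ge0_fin_numE; first exact: le_lt_trans (f1 j) (ltry _).
  by apply: le_trans xz; rewrite lee_fin edist_ge0.
have D0 j : (0 <= D j)%R.
  have [f0|/set0P[x fx]] := eqVneq (f j) set0; first by rewrite /D f0 eqxx.
  exact: le_trans (edist_ge0 x x) (Dle _ _ _ fx fx).
have gaugeE j : hausdorff_gauge k (f j) =
    (ball_volume R k / (4 * L) ^+ k)%:E * ((2 * (L * D j)) ^+ k)%:E.
  rewrite /hausdorff_gauge -EFinM; have := Dle j; rewrite /D.
  case: eqVneq => [f0 _|/set0P[x fx] /(_ _ _ fx fx) _].
    by rewrite !mulr0 expr0n gtn_eqF// mulr0.
  have fin : ediameter (f j) \is a fin_num.
    rewrite ge0_fin_numE; first exact: le_lt_trans (f1 j) (ltry _).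
    by apply: le_trans (edist_le_ediameter fx fx); rewrite lee_fin edist_ge0.
  rewrite -{1}(fineK fin) -EFinM -EFin_expe -EFinM; congr EFin.
  rewrite -mulrA; congr (_ * _)%R; rewrite -exprVn -exprMn; congr (_ ^+ _)%R.
  by field; rewrite gt_eqF.
under eq_eseriesr do rewrite gaugeE.
rewrite nneseriesZl; last by move=> j _; rewrite lee_fin exprn_ge0// !mulr_ge0// ltW.
have -> : (ball_volume R k * (rho / (4 * L)) ^+ k = ball_volume R k / (4 * L) ^+ k * rho ^+ k)%R.
  by rewrite expr_div_n; ring.
rewrite [leLHS]EFinM; apply: lee_wpmul2l.
  by rewrite lee_fin divr_ge0 ?ball_volume_ge0// exprn_ge0// mulr_ge0// ltW.
have := @box_cover_volume R k a (fun i => a i + rho)%R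
  (fun j i => P (y j) i - L * D j)%R (fun j i => P (y j) i + L * D j)%R.
rewrite (eq_bigr (fun=> rho)); last by move=> i _; rewrite addrAC subrr add0r.
rewrite prodr_const card_ord; under [X in _ -> _ -> _ -> _ <= X]eq_eseriesr => j _.
  rewrite (eq_bigr (fun=> 2 * (L * D j))%R); last by move=> i _; ring.
  rewrite prodr_const card_ord; over.
apply=> [i _|j i _|w /surj[x Sx Pw]].
- by rewrite lerDl.
- by have := mulr_ge0 (ltW L0) (D0 j); lra.
have [j _ fx] := cov _ Sx; exists j => i ik; rewrite -(Pw i ik).
have fy : f j (y j) by rewrite /y; apply: xgetPex; exists x.
rewrite -ler_distl; apply: le_trans (Plip _ _ _) _.
by rewrite ler_pM2l//; exact: Dle.
Qed.

Lemma ball_volume_gt0 (R : realType) (k : nat) : (0 < ball_volume R k)%R.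
Proof.
suff [] : (0 < ball_volume R k /\ 0 < ball_volume R k.+1)%R by [].
elim: k => [|k [vk vk1]] //=; split => //.
by rewrite mulr_gt0// divr_gt0// mulr_gt0// pi_gt0.
Qed.

(** * Boundary density and curvature of convex sets *)

Section convex.
Context (R : realType) (d : nat).
Local Notation V := 'rV[R]_d.+1.
Implicit Types (Omega : set V) (x y : V).

Lemma convex_setP Omega x y (t : R) : @convex_set R V Omega -> Omega x -> Omega y ->
  (0 <= t <= 1)%R -> Omega (t *: x + (1 - t) *: y)%R.
Proof.
move=> cO Ox Oy /andP[t0 t1].
by have := cO x y (Itv01 t0 t1) (mem_set Ox) (mem_set Oy); rewrite inE.
Qed.

(** The weight missing from the sum goes to [x]. In the induction the weight of the head is split
    off and the others are divided by [1 - l i], which is positive because the total is strictly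
    below one. *)
Lemma convex_set_sum (I : Type) (s : seq I) (l : I -> R) (p : I -> V) Omega x :
  @convex_set R V Omega -> Omega x -> (forall i, Omega (p i)) ->
  (forall i, 0 <= l i)%R -> (\sum_(i <- s) l i < 1)%R ->
  Omega (x + \sum_(i <- s) l i *: (p i - x))%R.
Proof.
move=> cO Ox Op; elim: s l => [|i s IH] l l0; first by rewrite !big_nil addr0.
rewrite !big_cons => l1.
have s0 : (0 <= \sum_(j <- s) l j)%R by exact: sumr_ge0.
have li : (l i < 1)%R by lra.
have li' : (1 - l i != 0)%R by rewrite gt_eqF// subr_gt0.
have := IH (fun j => l j / (1 - l i))%R.
rewrite -mulr_suml ltr_pdivrMr ?subr_gt0// mul1r.
have -> : (\sum_(j <- s) (l j / (1 - l i)) *: (p j - x) =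
    (1 - l i)^-1 *: \sum_(j <- s) l j *: (p j - x))%R.
  by rewrite scaler_sumr; apply: eq_bigr => j _; rewrite scalerA mulrC.
set S := (\sum_(j <- s) l j *: (p j - x))%R => IHs.
have Oz : Omega (x + (1 - l i)^-1 *: S)%R.
  by apply: IHs => [j|]; [rewrite divr_ge0// subr_ge0 ltW|lra].
have lt1 : (0 <= l i <= 1)%R by rewrite l0 ltW.
have := convex_setP cO (Op i) Oz lt1.
rewrite [((1 - l i) *: (_ + _))%R]scalerDr scalerA mulfV// scale1r.
congr (Omega _).
by apply/rowP => j; rewrite !mxE; ring.
Qed.

(* Diagonal dominance: [`|l E| <= max l / 4] gives both injectivity of [1 + E] and the bounds. *)
Lemma near_identity_solve (E : 'M[R]_d.+1) (z : V) (eta tau : R) :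
  (0 <= tau)%R -> (0 <= eta)%R -> (d.+1%:R * eta <= 4^-1)%R ->
  (forall i j, `|E i j| <= eta)%R -> (forall i, 3 / 4 * tau <= z ord0 i <= 5 / 4 * tau)%R ->
  exists2 l : V, (l *m (1%:M + E) = z)%R & forall i, (0 <= l ord0 i <= 2 * tau)%R.
Proof.
move=> tau0 eta0 Neta Eeta ztau.
have lE (l : V) (M : R) : (forall i, `|l ord0 i| <= M)%R -> forall i, (`|(l *m E)%R ord0 i| <= 4^-1 * M)%R.
  move=> lM i; have M0 : (0 <= M)%R by exact: le_trans (lM i).
  rewrite mxE; apply: le_trans (ler_norm_sum _ _ _) _.
  apply: (@le_trans _ _ (\sum_(j < d.+1) M * eta)%R).
    by apply: ler_sum => j _; rewrite normrM ler_pM.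
  by rewrite sumr_const card_ord -mulr_natr; nra.
have max_norm (l : V) : exists2 M, (forall i, `|l ord0 i| <= M)%R & exists i, M = `|l ord0 i|%R.
  have [i _ iM] := @Order.TotalTheory.arg_maxP _ _ _ (@ord0 d) xpredT (fun i => `|l ord0 i|%R) isT.
  by exists `|l ord0 i|%R; [move=> j; exact: iM|exists i].
have unit : (1%:M + E)%R \in unitmx.
  rewrite -row_free_unit -kermx_eq0; apply/rowV0P => l; rewrite sub_kermx => /eqP.
  rewrite mulmxDr mulmx1 => lE0.
  have [M lM [i Mi]] := max_norm l.
  have := lE _ _ lM i; have -> : (l *m E = - l)%R by rewrite -(addKr l (l *m E)%R) lE0 addr0.
  rewrite mxE normrN -Mi => M4; have M0 : (M <= 0)%R by lra.
  apply/rowP => j; rewrite mxE; apply/eqP; rewrite -normr_le0.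
  exact: le_trans (lM j) M0.
exists (z *m invmx (1%:M + E)%R)%R; first by rewrite mulmxKV.
set l := (z *m _)%R.
have lz : (l = z - l *m E)%R.
  by apply/eqP; rewrite eq_sym subr_eq -[X in (X + _)%R]mulmx1 -mulmxDr mulmxKV.
have [M lM [i Mi]] := max_norm l.
have zi j : (`|z ord0 j| <= 5 / 4 * tau)%R.
  by have /andP[z1 z2] := ztau j; rewrite ger0_norm//; apply: le_trans z1; rewrite mulr_ge0.
(* [M <= 5/4 tau + M/4] gives this bound. The error [M/4] is then at most [5/12 tau], so the entries
   of [l] lie between [1/3 tau] and [5/3 tau]. *)
have M53 : (M <= 5 / 3 * tau)%R.
  have : (M <= 5 / 4 * tau + 4^-1 * M)%R; last by lra.
  rewrite {1}Mi lz !mxE; apply: le_trans (ler_normB _ _) _; apply: lerD; first exact: zi.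
  by have := lE _ _ lM i; rewrite mxE.
move=> j; have := lE _ _ lM j; rewrite ler_norml => /andP[e1 e2].
have /andP[z1 z2] := ztau j.
have -> : (l ord0 j = z ord0 j - (l *m E) ord0 j)%R.
  by have /rowP/(_ j) := lz; rewrite !mxE.
move: (z ord0 j) ((l *m E) ord0 j)%R (M : R) e1 e2 z1 z2 M53 => zj ej M' e1 e2 z1 z2 M53.
by clear -e1 e2 z1 z2 M53; apply/andP; split; lra.
Qed.

(** Each [p i] is close to [x] moved by [r * sg i] along the [i]-th axis. After rescaling and
    changing signs, the edge matrix of the simplex is a perturbation of the identity, so
    [near_identity_solve] yields barycentric coordinates of [y]: nonnegative and at most [2 / (3 N)]
    each, hence of sum at most [2/3]. *)
Lemma convex_set_simplex Omega (x : V) (p : 'I_d.+1 -> V) (sg : 'I_d.+1 -> R) (r : R) (y : V) :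
  @convex_set R V Omega -> Omega x -> (forall i, Omega (p i)) ->
  (0 < r)%R -> (forall i, sg i ^+ 2 = 1)%R ->
  (forall i j, `|p i ord0 j - x ord0 j - r * sg i * (i == j)%:R| <= r / (4 * d.+1%:R))%R ->
  (forall i, 3 / 4 * (r / (3 * d.+1%:R)) <= sg i * (y ord0 i - x ord0 i)
             <= 5 / 4 * (r / (3 * d.+1%:R)))%R ->
  Omega y.
Proof.
move=> cO Ox Op r0 sg2 px yx; set N : R := d.+1%:R.
have N0 : (0 < N)%R by rewrite ltr0n.
have sg1 i : (`|sg i| = 1)%R.
  by apply/eqP; rewrite -(@pexpr_eq1 _ _ 2)// -normrX sg2 normr1.
pose E : 'M[R]_d.+1 := (\matrix_(i, j) (sg j * (p i ord0 j - x ord0 j) / r - (i == j)%:R))%R.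
pose z : V := (\row_j (sg j * (y ord0 j - x ord0 j) / r))%R.
have [||||i|l lz l0] := @near_identity_solve E z (4 * N)^-1%R (3 * N)^-1%R.
- by rewrite invr_ge0 mulr_ge0// ltW.
- by rewrite invr_ge0 mulr_ge0// ltW.
- by rewrite invfM mulrCA mulfV ?mulr1// gt_eqF.
- move=> i j; rewrite mxE.
  have -> : (sg j * (p i ord0 j - x ord0 j) / r - (i == j)%:R =
     sg j * (p i ord0 j - x ord0 j - r * sg i * (i == j)%:R) / r)%R.
    case: eqVneq => [->|_]; last by rewrite !mulr0 !subr0.
    rewrite (_ : true%:R = 1 :> R)%R// mulr1 -[X in (_ - X)%R = _](sg2 j).
    by field; rewrite gt_eqF.
  rewrite !normrM sg1 mul1r normfV (gtr0_norm r0) ler_pdivrMr//.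
  by apply: le_trans (px i j) _; rewrite mulrC.
- have NF (c : R) : (c / (3 * N) = c * (r / (3 * N)) / r)%R by field; rewrite !gt_eqF.
  by have /andP[y1 y2] := yx i; rewrite mxE (NF (3 / 4)%R) (NF (5 / 4)%R) !ler_pM2r ?invr_gt0// y1 y2.
have -> : (y = x + \sum_i l ord0 i *: (p i - x))%R.
  apply/rowP => j; rewrite mxE summxE.
  have /rowP/(_ j) := lz; rewrite !mxE => lzj.
  have -> : (\sum_i (l ord0 i *: (p i - x)) ord0 j =
      r * sg j * \sum_i l ord0 i * (1%:M + E) i j)%R.
    rewrite mulr_sumr; apply: eq_bigr => i _; rewrite !mxE.
    rewrite subrKC; transitivity (sg j ^+ 2 * (l ord0 i * (p i ord0 j - x ord0 j)))%R.
      by rewrite sg2 mul1r.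
    by field; rewrite gt_eqF.
  rewrite lzj; transitivity (x ord0 j + sg j ^+ 2 * (y ord0 j - x ord0 j))%R.
    by rewrite sg2 mul1r subrKC.
  by field; rewrite gt_eqF.
apply: convex_set_sum => // [i|]; first by have /andP[] := l0 i.
apply: (@le_lt_trans _ _ (\sum_(i < d.+1) 2 * (3 * N)^-1)%R).
  by apply: ler_sum => i _; have /andP[] := l0 i.
rewrite sumr_const card_ord -[ltLHS]mulr_natr -/N.
have -> : (2 * (3 * N)^-1 * N = 2 / 3 :> R)%R by field; rewrite gt_eqF.
lra.
Qed.

End convex.

Lemma boundary_open (T : topologicalType) (A : set T) : open A ->
  boundary A = closure A `\` A.
Proof. by move=> /interior_id; rewrite /boundary => ->. Qed.

(** The crossing time is the supremum of the times spent outside [Omega]. Openness keeps that point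
    outside, while all later times are inside and put it in the closure. *)
Lemma open_path_boundary (R : realType) (T : topologicalType) (Omega : set T)
    (f : R -> T) (a b : R) :
  open Omega -> continuous f -> (a <= b)%R -> ~ Omega (f a) -> Omega (f b) ->
  exists2 t, (a <= t <= b)%R & boundary Omega (f t).
Proof.
move=> oO cf ab fa fb; pose A := [set t | (a <= t <= b)%R /\ ~ Omega (f t)].
have Aa : A a by split=> //; rewrite lexx.
have supA : has_sup A by split; [exists a|exists b => t [/andP[]]].
have ub := sup_upper_bound supA; have ta : (a <= sup A)%R by exact: ub.
have tb : (sup A <= b)%R by apply: ge_sup => //; [exists a|move=> t [/andP[]]].
have nOt : ~ Omega (f (sup A)).
  move=> Ot.
  have /nbhs_ballP[e /= e0 te] : nbhs (sup A) (f @^-1` Omega).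
    by apply: cf; apply: open_nbhs_nbhs; split.
  have [s [/andP[as_ sb] fs] ets] := sup_adherent e0 supA.
  apply: (fs); apply: te; rewrite /ball/= ger0_norm ?subr_ge0.
    by rewrite ltrBlDr -ltrBlDl.
  by apply: ub; split=> //; rewrite as_.
exists (sup A); rewrite ?ta// boundary_open//; split=> // B fB.
have /nbhs_ballP[e /= e0 te] : nbhs (sup A) (f @^-1` B) by exact: cf.
have tb' : (sup A < b)%R by rewrite lt_neqAle tb andbT; apply/eqP => tb'; apply: nOt; rewrite tb'.
pose s := Num.min b (sup A + e / 2)%R.
have ts : (sup A < s)%R by rewrite lt_min tb' ltrDl divr_gt0.
exists (f s); split.
  apply: contrapT => nOs; have : A s by split; rewrite // (le_trans ta (ltW ts)) ge_min lexx.
  by move/ub; rewrite leNgt ts.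
apply: te; rewrite /ball/= distrC ger0_norm ?subr_ge0 ?ltW//.
rewrite ltrBlDl (@le_lt_trans _ _ (sup A + e / 2)%R) ?ge_min ?lexx ?orbT//.
by rewrite ltrD2l ltr_pdivrMr// ltr_pMr// ltr1n.
Qed.

Section boundary_density.
Context (R : realType) (d : nat).
Local Notation V := 'rV[R]_d.+1.
Variables (Omega : set V) (x : V).
Hypotheses (oO : open Omega) (cO : @convex_set R V Omega) (bx : boundary Omega x).

(** Otherwise the midpoint [x] would belong to [Omega], which is open and so disjoint from its
    boundary. *)
Lemma convex_boundary_reflection (y : V) : Omega y -> ~ Omega (point_reflection x y).
Proof.
move=> Oy Oy'; have := bx; rewrite boundary_open// => -[_]; apply.
have half : (0 <= (2^-1 : R) <= 1)%R by lra.
have := convex_setP cO Oy Oy' half; congr (Omega _).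
by apply/rowP => i; rewrite !mxE; field.
Qed.

Variables (r : R) (sg : 'I_d.+1 -> R) (p : 'I_d.+1 -> V).
Hypotheses (r0 : (0 < r)%R) (sg2 : forall i, (sg i ^+ 2 = 1)%R).
Hypothesis Op : forall i, Omega (p i).
Let N : R := d.+1%:R.
(** The cube of half-side [tau / 8] whose centre has all signed coordinates equal to [tau] will lie
    inside [Omega], and the opposite one outside. *)
Let tau := (r / (3 * N))%R.
Hypothesis px : forall i j,
  (`|p i ord0 j - x ord0 j - r * sg i * (i == j)%:R| <= r / (8 * N))%R.

Let N1 : (1 <= N)%R. Proof. by rewrite ler1n. Qed.
Let Nn0 : (N != 0)%R. Proof. by rewrite pnatr_eq0. Qed.
Let tau0 : (0 < tau)%R. Proof. by rewrite divr_gt0// mulr_gt0// ltr0n. Qed.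
Let sg1 i : (`|sg i| = 1)%R.
Proof. by apply/eqP; rewrite -(@pexpr_eq1 _ _ 2)// -normrX sg2 normr1. Qed.

(* The point [x] of the closure is replaced by a nearby point of [Omega], which with the [p i] spans a
   simplex containing the cube. *)
Lemma convex_contains_cube (y : V) :
  (forall i, `|sg i * (y ord0 i - x ord0 i) - tau| <= tau / 8)%R -> Omega y.
Proof.
move=> yx; have tau80 : (0 < tau / 8)%R by exact: divr_gt0.
have [z [Oz /ball_rVP[_ xz]]] := bx.1 _ (nbhsx_ballx x _ tau80).
apply: (convex_set_simplex cO Oz Op r0 sg2) => [i j|i].
  have -> : (p i ord0 j - z ord0 j - r * sg i * (i == j)%:R =
    (p i ord0 j - x ord0 j - r * sg i * (i == j)%:R) + (x ord0 j - z ord0 j))%R by ring.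
  apply: le_trans (ler_normD _ _) _; apply: le_trans (lerD (px i j) (ltW (xz j))) _.
  (* The error [r / (8 N)] of the vertices and the displacement [tau / 8 = r / (24 N)] of the base
     point add up to [r / (6 N)], within the [r / (4 N)] allowed by [convex_set_simplex]. *)
  rewrite /tau -/N (_ : r / (4 * N) = 6 / 24 * (r / N))%R; last by field.
  rewrite (_ : r / (8 * N) + _ = 4 / 24 * (r / N))%R; last by field.
  have : (0 <= r / N)%R by rewrite divr_ge0// ltW.
  by move: (r / N)%R => t t0; lra.
have := yx i; rewrite -/N -/tau ler_norml => /andP[y1 y2].
have : (`|sg i * (x ord0 i - z ord0 i)| <= tau / 8)%R by rewrite normrM sg1 mul1r ltW.
rewrite ler_norml => /andP[z1 z2].
have -> : (sg i * (y ord0 i - z ord0 i) =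
   sg i * (y ord0 i - x ord0 i) + sg i * (x ord0 i - z ord0 i))%R by ring.
by apply/andP; split; lra.
Qed.

(** Reflection across [x] carries this cube onto the one contained in [Omega]. *)
Lemma convex_avoids_cube (y : V) :
  (forall i, `|sg i * (y ord0 i - x ord0 i) + tau| <= tau / 8)%R -> ~ Omega y.
Proof.
move=> yx; rewrite -(point_reflectionK x y); apply: convex_boundary_reflection.
apply: convex_contains_cube => i; rewrite !mxE -normrN.
by apply: le_trans (yx i); rewrite le_eqVlt; apply/predU1P; left; congr (`|_|)%R; ring.
Qed.

(* In the coordinates [sg i * (y i - x i)] the diagonal lines from [- tau (1, .., 1)] to
   [tau (1, .., 1)] and their small translates leave one cube and enter the other, hence cross the
   boundary; projecting along the diagonal covers a [d]-dimensional cube. *)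
Lemma hausdorff_boundary_ge : (0 < d)%N ->
  (ball_volume R d * (r / (96 * N)) ^+ d)%:E <=
  hausdorff_outer R d.+1 d (boundary Omega `&` ball x r).
Proof.
move=> d0.
pose P (y : V) i := (sg (inord i.+1) * (y ord0 (inord i.+1) - x ord0 (inord i.+1)) -
  sg ord0 * (y ord0 ord0 - x ord0 ord0))%R.
(* The projected cube has side [rho = tau / 4], and [P], a difference of two signed coordinates, has
   Lipschitz constant [L = 2]. *)
have -> : (r / (96 * N) = tau / 4 / (4 * 2))%R by rewrite /tau; field.
apply: (hausdorff_ge_projection (P := P) (a := fun=> (- (tau / 8))%R)) => //.
- by rewrite divr_ge0// ltW.
- move=> y z i; rewrite /P.
  rewrite (_ : _ - _ = sg (inord i.+1) * (y ord0 (inord i.+1) - z ord0 (inord i.+1)) -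
     sg ord0 * (y ord0 ord0 - z ord0 ord0))%R; last by ring.
  apply: le_trans (ler_normB _ _) _; rewrite !normrM !sg1 !mul1r mulr_natl mulr2n.
  by apply: lerD; exact: norm_coord_le_edist.
move=> w wtau.
(* The diagonal line over [w] is shifted by [w] in all coordinates but the first. At times [- tau]
   and [tau] the shift, at most [tau / 8], keeps it within the two cubes. *)
pose w' (j : 'I_d.+1) := if j == ord0 then 0%R else w j.-1.
have w'tau j : (`|w' j| <= tau / 8)%R.
  rewrite /w'; case: eqVneq => [_|j0]; first by rewrite normr0 divr_ge0// ltW.
  have jd : (j.-1 < d)%N by rewrite -ltnS prednK ?ltn_ord// lt0n.
  by have := wtau _ jd; rewrite ler_norml => /andP[w1 w2]; apply/andP; split; lra.
pose f (t : R) : V := (\row_j (x ord0 j + sg j * (t + w' j)))%R.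
have cf : continuous f.
  move=> t; apply/cvg_ballP => e e0; apply: filterS (nbhsx_ballx t e e0) => s ts.
  apply/ball_rVP; split=> // i.
  rewrite !mxE (_ : _ - _ = sg i * (t - s))%R; last by ring.
  by rewrite normrM sg1 mul1r.
have fE t j : (sg j * (f t ord0 j - x ord0 j) = t + w' j)%R.
  by rewrite mxE addrAC subrr add0r mulrA -expr2 sg2 mul1r.
have [|||t /andP[t1 t2] bt] := @open_path_boundary R _ Omega f (- tau)%R tau oO cf.
- by have := tau0; lra.
- by apply: convex_avoids_cube => i; rewrite fE addrAC addNr add0r.
- by apply: convex_contains_cube => i; rewrite fE addrAC subrr add0r.
exists (f t).
  split=> //; apply/ball_rVP; split=> // i.
  rewrite mxE opprD addNKr normrN normrM sg1 mul1r.
  apply: le_lt_trans (ler_normD _ _) _.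
  have : (`|t| <= tau)%R by rewrite ler_norml t1.
  have : (tau * 3 <= r)%R.
    rewrite (_ : tau * 3 = r / N)%R; last by rewrite /tau; field.
    by rewrite ler_pdivrMr ?(lt_le_trans ltr01)// ler_peMr// ltW.
  have := w'tau i; have := tau0; lra.
move=> i id; rewrite /P !fE /w' eqxx.
have /negbTE -> : inord i.+1 != ord0 :> 'I_d.+1 by rewrite -val_eqE/= inordK.
by rewrite inordK//= addr0 addrAC subrr add0r.
Qed.

End boundary_density.

Definition density_constant (R : realType) (d : nat) : R :=
  (ball_volume R d / (96 * d.+1%:R) ^+ d)%R.

(** This is what [curvature_ge_cube] gives, up to the factor [r ^ (- a)], for a cube of half-side
    [r / (8 (d + 1))] all of whose points are within [2 (d + 1) r] of [x]. *)
Definition curvature_constant (R : realType) (d : nat) (a : R) : R :=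
  (a / 2 * ((2 * d.+1%:R) `^ (- (d.+1%:R + a)) * (4 * d.+1%:R)^-1 ^+ d.+1))%R.

Lemma density_constant_gt0 (R : realType) (d : nat) : (0 < density_constant R d)%R.
Proof. by rewrite divr_gt0 ?ball_volume_gt0// exprn_gt0// mulr_gt0. Qed.

Lemma curvature_constant_gt0 (R : realType) (d : nat) (a : R) : (0 < a)%R ->
  (0 < curvature_constant d a)%R.
Proof.
by move=> a0; rewrite mulr_gt0 ?divr_gt0// mulr_gt0 ?powR_gt0 ?mulr_gt0.
Qed.

(* Put a small cube around [x + r e_i] for each axis [e_i]. If one of them lies outside both [Omega]
   and its reflection, it alone makes the curvature large. Otherwise each axis has, up to sign, a
   point of [Omega] near distance [r], and the boundary is crossed by many lines. *)
Lemma boundary_dichotomy (R : realType) (d : nat) (a : R) (Omega : set 'rV[R]_d.+1)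
    (x : 'rV[R]_d.+1) (r : R) :
  (0 < d)%N -> (0 < a)%R -> open Omega -> @convex_set R 'rV[R]_d.+1 Omega ->
  boundary Omega x -> (0 < r)%R ->
  (density_constant R d * r ^+ d)%:E <= surface_measure R d (boundary Omega `&` ball x r) \/
  (curvature_constant d a * r `^ (- a))%:E <= nonlocal_mean_curvature a Omega x.
Proof.
move=> d0 a0 oO cO bx r0; set N : R := d.+1%:R.
have N1 : (1 <= N)%R by rewrite ler1n.
have N0 : (0 < N)%R by exact: lt_le_trans N1.
have Nn0 : (N != 0)%R by rewrite gt_eqF.
have r8N : (0 < r / (8 * N))%R by rewrite divr_gt0// mulr_gt0.
have r8 : (r / (8 * N) <= r / 8)%R.
  by rewrite ler_pM2l// lef_pV2 ?posrE ?mulr_gt0// ler_peMr.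
pose q i := (x + r *: delta_mx 0 i)%R : 'rV[R]_d.+1.
have qE (y : 'rV[R]_d.+1) i : cube (q i) (r / (8 * N)) y ->
    forall j, (`|y ord0 j - x ord0 j - r * (i == j)%:R| <= r / (8 * N))%R.
  move=> /cubeP qy j; have := qy j; rewrite !mxE eqxx/= [j == i]eq_sym => /andP[y1 y2].
  by rewrite ler_norml; apply/andP; split; move: (i == j) (r / (8 * N))%R y1 y2 => b t y1 y2; lra.
have [[i qi]|none] := pselect (exists i, cube (q i) (r / (8 * N)) `<=` reflected_exterior Omega x).
  right.
  have r20 : (0 < r / 2)%R by rewrite divr_gt0.
  have bounds y : cube (q i) (r / (8 * N)) y -> (r / 2 <= edist y x <= N * (2 * r))%R.
    move=> /qE qy; apply/andP; split.
      apply: le_trans (norm_coord_le_edist y x i); apply: le_trans (ler_norm _).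
      have := qy i; rewrite eqxx mulr1 ler_norml => /andP[+ _].
      by move: r8; move: (r / (8 * N))%R => t; lra.
    apply: edist_le_norm_coord => [|j]; first by rewrite mulr_ge0// ltW.
    have := qy j; rewrite !ler_norml => /andP[y1 y2].
    have b0 : (0 <= r * (i == j)%:R)%R by rewrite mulr_ge0// ltW.
    have b1 : (r * (i == j)%:R <= r)%R by case: (i == j); [rewrite mulr1|rewrite mulr0 ltW].
    move: y1 y2 b0 b1 r8; move: (r / (8 * N))%R (r * (i == j)%:R)%R => t b y1 y2 b0 b1 t8.
    by apply/andP; split; lra.
  apply: le_trans (curvature_ge_cube a0 r20 (ltW r8N) oO
    (convex_boundary_reflection oO cO bx) qi bounds).
  rewrite lee_fin /curvature_constant -/N le_eqVlt; apply/predU1P; left.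
  have -> : ((N * (2 * r)) `^ (- (N + a)) = (2 * N) `^ (- (N + a)) * (r ^- d.+1 * r `^ (- a)))%R.
    rewrite (_ : N * (2 * r) = (2 * N) * r)%R; last by ring.
    rewrite powRM ?mulr_ge0 ?(ltW N0) ?(ltW r0)//; congr (_ * _)%R.
    by rewrite opprD powRD ?(gt_eqF r0) ?implybT// powR_invn// ltW.
  have -> : (2 * (r / (8 * N)) = (4 * N)^-1 * r)%R by field.
  have rd0 : (r ^+ d.+1 != 0)%R by rewrite expf_neq0// gt_eqF.
  rewrite exprMn; move: (_ ^-1 ^+ d.+1)%R (r ^+ d.+1)%R (r `^ _)%R (_ `^ _)%R rd0 => A B C D B0.
  by field.
left.
(* A point of the cube that is not in the exterior lies in [Omega], giving the sign [1], or has its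
   reflection in [Omega], giving the sign [-1]. *)
have pt i : exists ps : 'rV[R]_d.+1 * R, [/\ Omega ps.1, (ps.2 ^+ 2 = 1)%R &
    forall j, (`|ps.1 ord0 j - x ord0 j - r * ps.2 * (i == j)%:R| <= r / (8 * N))%R].
  have [y [qy ny]] : exists y, cube (q i) (r / (8 * N)) y /\ ~ reflected_exterior Omega x y.
    apply: contrapT => H; apply: none; exists i => y qy; apply: contrapT => ny.
    by apply: H; exists y.
  have [Oy|nOy] := pselect (Omega y).
    by exists (y, 1%R); split=> //= [|j]; rewrite ?expr1n// mulr1; exact: qE.
  exists (point_reflection x y, (-1)%R); split=> /=.
  - by apply: contrapT => nOy'; apply: ny; split.
  - by rewrite sqrrN expr1n.
  move=> j; apply: le_trans (qE _ _ qy j); rewrite -normrN le_eqVlt; apply/predU1P; left.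
  by rewrite !mxE; congr (`|_|)%R; ring.
have [ps psE] := choice pt.
have := @hausdorff_boundary_ge R d Omega x oO cO bx r (fun i => (ps i).2) (fun i => (ps i).1) r0
  (fun i => let: And3 _ h _ := psE i in h) (fun i => let: And3 h _ _ := psE i in h)
  (fun i => let: And3 _ _ h := psE i in h) d0.
rewrite (_ : ball_volume R d * _ = density_constant R d * r ^+ d)%R//.
by rewrite /density_constant expr_div_n -/N; ring.
Qed.

(* No measurability is needed, as integrals of nonnegative functions are suprema. This matters for the
   inner Gagliardo integrals and for the curvature, whose measurability is never established. *)
Lemma ge0_le_integral_subset (d : measure_display) (T : measurableType d) (R : realType)
    (mu : {measure set T -> \bar R}) (A D : set T) (f g : T -> \bar R) :
  A `<=` D -> (forall x, A x -> 0 <= f x) -> (forall x, D x -> 0 <= g x) ->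
  (forall x, A x -> f x <= g x) ->
  \int[mu]_(x in A) f x <= \int[mu]_(x in D) g x.
Proof.
move=> AD f0 g0 fg; rewrite integral_mkcond [leRHS]integral_mkcond.
rewrite !ge0_integralTE; last 2 first.
- by move=> x; apply: erestrict_ge0.
- by move=> x; apply: erestrict_ge0.
apply: ereal_sup_le => _ [h hf <-]; exists h => // x; apply: le_trans (hf x) _.
rewrite !patchE; case: ifPn => [/[!inE] Ax|_]; first by rewrite mem_set ?fg//; exact: AD.
by case: ifPn => // /[!inE] Dx; exact: g0.
Qed.

(** * Measurable dependence of the measure of balls on centre and radius *)

Section surface.
Context (R : realType) (d : nat).
Local Notation V := 'rV[R]_d.+1.
Local Notation sigma := (surface_measure R d).
Local Notation T := (caratheodory_type (hausdorff_outer R d.+1 d)).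

Lemma surface_continuous (f : V -> R) : continuous f -> measurable_fun [set: T] (f : T -> R).
Proof. by apply: continuous_caratheodory; exact: hausdorff_halfspace. Qed.

Lemma measurable_boundary (Omega : set V) : open Omega -> measurable (boundary Omega : set T).
Proof.
move=> oO; rewrite boundary_open//; apply: measurableD; last exact: hausdorff_open.
rewrite -[X in measurable X]setCK; apply: measurableC; apply: hausdorff_open.
by rewrite openC; exact: closed_closure.
Qed.

Lemma measurable_ball (x : V) r : measurable (ball x r : set T).
Proof.
by apply: hausdorff_open; exact: (@ball_open _ _ x r).
Qed.

Variable M : set V.
Hypothesis mM : measurable (M : set T).

Let G (x : V) (r : R) := sigma (M `&` ball x r).

Let mMball x r : measurable (M `&` ball x r : set T).
Proof. by apply: measurableI => //; exact: measurable_ball. Qed.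

Lemma surface_ball_le x y r q : (forall z, ball x r z -> ball y q z) -> G x r <= G y q.
Proof.
by move=> xy; apply: le_measure; rewrite ?inE// => z [Mz /xy].
Qed.

(** Continuity of the measure from below along the radii [r - 1 / (k + 1)], the balls being open. *)
Lemma surface_ball_inner x r t : t < G x r -> exists2 q, (q < r)%R & t < G x q.
Proof.
move=> tG; pose F k := M `&` ball x (r - k.+1%:R^-1)%R.
have mF k : measurable (F k : set T) by exact: mMball.
have FU : \bigcup_k F k = M `&` ball x r.
  apply/seteqP; split=> [z [k _ [Mz /ball_rVP[_ xz]]]|z [Mz /ball_rVP[r0 xz]]].
    split=> //; apply/ball_rVP; have lt_r i : (`|x ord0 i - z ord0 i| < r)%R.
      by apply: lt_trans (xz i) _; rewrite ltrBlDr ltrDl invr_gt0.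
    by split=> //; exact: le_lt_trans (lt_r ord0).
  have [i _ iM] := @Order.TotalTheory.arg_maxP _ _ _ (@ord0 d) xpredT
    (fun i => `|x ord0 i - z ord0 i|%R) isT.
  have [k] := ltr_add_invr (xz i); rewrite -ltrBrDr => kr.
  exists k => //; split=> //; apply/ball_rVP; split; first exact: le_lt_trans kr.
  by move=> j; apply: le_lt_trans kr; exact: iM.
have ndF : nondecreasing_seq F.
  move=> j k jk; apply/subsetPset => z [Mz xz]; split=> //; apply: le_ball xz.
  by rewrite lerB// lef_pV2 ?posrE// ler_nat.
have cv := nondecreasing_cvg_mu (mu := sigma) mF (bigcupT_measurable _ mF) ndF.
apply: contrapT => no.
suff : G x r <= t by rewrite leNgt tG.
rewrite /G -FU -(cvg_lim _ cv)//; apply: lime_le; first by apply/cvg_ex; eexists; exact: cv.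
near=> k; rewrite leNgt; apply/negP => tk; apply: no.
by exists (r - k.+1%:R^-1)%R; rewrite // ltrBlDr ltrDl invr_gt0.
Unshelve. all: by end_near. Qed.

(** Lower semicontinuity in the centre: a slightly smaller radius [q] still exceeds [t], and leaves
    room [r - q] for moving the centre. *)
Lemma surface_ball_gt_open (r : R) t : open [set x | t < G x r].
Proof.
rewrite openE => x /surface_ball_inner[q qr tq].
have rq0 : (0 < r - q)%R by rewrite subr_gt0.
apply: filterS (nbhsx_ballx x _ rq0) => y /ball_rVP[_ xy].
apply: lt_le_trans tq _; apply: surface_ball_le => z /ball_rVP[q0 xz].
apply/ball_rVP; split; first exact: lt_trans qr.
move=> i; apply: le_lt_trans (ler_distD (x ord0 i) _ _) _.
by rewrite -[ltRHS](subrK q) ltrD// distrC.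
Qed.

(** The radius varies with the point. A rational radius [q] just below [r x] decouples the two: each
    condition on [q] is measurable, and there are countably many. *)
Lemma measurable_surface_ball (D : set V) (r : V -> R) : measurable (D : set T) ->
  measurable_fun (D : set T) (r : T -> R) ->
  measurable_fun (D : set T) ((fun x => G x (r x)) : T -> \bar R).
Proof.
move=> mD mr; apply: (measurability _ (ErealGenOInfty.measurableE R)) => // _ [_ [t ->] <-].
have -> : D `&` (fun x => G x (r x)) @^-1` `]t%:E, +oo[ =
    \bigcup_(q : rat) ((D `&` r @^-1` `]ratr q, +oo[) `&` [set x | t%:E < G x (ratr q)]).
  apply/seteqP; split=> [x [Dx]|x [q _ [[Dx]]]].
    rewrite /= in_itv/= andbT => /surface_ball_inner[q qr tq].
    have [q' /[!in_itv]/= /andP[qq' q'r]] := rat_in_itvoo qr.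
    exists q' => //; split; first by split=> //=; rewrite in_itv/= q'r.
    by apply: lt_le_trans tq _; apply: surface_ball_le => z; apply: le_ball; exact: ltW.
  rewrite /= in_itv/= andbT => qr tq; split=> //=; rewrite in_itv/= andbT.
  by apply: lt_le_trans tq _; apply: surface_ball_le => z; apply: le_ball; exact: ltW.
apply: bigcupT_measurable_rat => q; apply: measurableI; first by apply: mr.
by apply: hausdorff_open; exact: surface_ball_gt_open.
Qed.

(** [D] is split according to the alternative that holds at each point. Additivity is applied to the
    measurable [g] only; [f1] and [f2] enter by comparison on one piece each. *)
Lemma integral_dichotomy (D : set V) (r g : V -> R) (f1 f2 : V -> \bar R) (c : R) :
  measurable (D : set T) -> measurable_fun (D : set T) (r : T -> R) ->
  measurable_fun (D : set T) (g : T -> R) -> (forall x, D x -> 0 <= g x)%R ->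
  (forall x, D x -> 0 <= f1 x) -> (forall x, D x -> 0 <= f2 x) ->
  (forall x, D x -> (c * r x ^+ d)%:E < G x (r x) -> (g x)%:E <= f1 x) ->
  (forall x, D x -> G x (r x) <= (c * r x ^+ d)%:E -> (g x)%:E <= f2 x) ->
  \int[sigma]_(x in D) (g x)%:E <= \int[sigma]_(x in D) f1 x + \int[sigma]_(x in D) f2 x.
Proof.
move=> mD mr mg g0 f10 f20 gf1 gf2.
pose D1 := D `&` [set x | (c * r x ^+ d)%:E < G x (r x)].
have mcr : measurable_fun (D : set T) ((fun x => (c * r x ^+ d)%:E) : T -> \bar R).
  apply/measurable_EFinP; apply: measurable_funM; first exact: measurable_cst.
  by apply: measurable_funX; exact: mr.
have mD1 : measurable (D1 : set T).
  by have := measurable_lte mD mcr (measurable_surface_ball mD mr); exact.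
have DE : D = D1 `|` (D `\` D1).
  by rewrite setDE setUIr setUCr setIT; apply/esym/setUidr => x [].
have mD2 : measurable (D `\` D1 : set T) by exact: measurableD mD mD1.
have disj : [disjoint D1 & D `\` D1] by apply/disj_setPS => x [D1x []].
have mg' : measurable_fun (D1 `|` D `\` D1 : set T) ((fun x => (g x)%:E) : T -> \bar R).
  by rewrite -DE; exact/measurable_EFinP.
have g0' x : (D1 `|` D `\` D1) x -> 0 <= (g x)%:E by rewrite -DE lee_fin; exact: g0.
rewrite {1}DE (ge0_integral_setU sigma mD1 mD2 mg' g0' disj).
apply: leeD; apply: ge0_le_integral_subset => //.
- by move=> x [].
- by move=> x [Dx _]; rewrite lee_fin g0.
- by move=> x [Dx]; exact: gf1.
- by move=> x [Dx _]; rewrite lee_fin g0.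
- move=> x [Dx nD1]; apply: gf2 => //; rewrite leNgt; apply/negP => lt1.
  by apply: nD1; split.
Qed.

End surface.

(** * Fractional inequalities on the boundary *)

Section kernel_bounds.
Context (R : realType) (d : nat).
Local Notation V := 'rV[R]_d.+1.
Local Notation sigma := (surface_measure R d).
Local Notation T := (caratheodory_type (hausdorff_outer R d.+1 d)).
Let N : R := d.+1%:R.

Lemma edist_gt0 (x y : V) : x != y -> (0 < edist x y)%R.
Proof.
apply: contra_neqT; rewrite -leNgt => xy0; apply/rowP => i; apply/eqP.
by rewrite -subr_eq0 -normr_le0; exact: le_trans (norm_coord_le_edist _ _ _) xy0.
Qed.

Lemma integral_kernel_ge (M B : set V) (x : V) (b m r : R) :
  measurable (M : set T) -> measurable (B : set T) -> B x ->
  (0 < b)%R -> (0 < m)%R -> (0 < r)%R ->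
  sigma B <= m%:E -> (2 * m)%:E < sigma (M `&` ball x r) ->
  ((N * r) `^ (- b) * m)%:E <= \int[sigma]_(z in M `\` B) ((edist z x `^ b)^-1)%:E.
Proof.
move=> mM mB Bx b0 m0 r0 Bm Mm; pose A := (M `&` ball x r) `\` B.
have mMb : measurable (M `&` ball x r : set T) by apply: measurableI => //; exact: measurable_ball.
have mA : measurable (A : set T) by exact: measurableD.
have Am : m%:E <= sigma A.
  rewrite leNgt; apply/negP => Am; move: Mm; apply/negP; rewrite -leNgt.
  apply: (@le_trans _ _ (sigma (A `|` B))).
    apply: le_measure; rewrite ?inE//; first exact: measurableU.
    by move=> z Mz; have [|nBz] := pselect (B z); [right|left].
  apply: le_trans (outer_measureU2 (hausdorff_outer R d.+1 d) A B) _.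
  by rewrite mulr_natl mulr2n EFinD; apply: leeD => //; exact: ltW.
apply: (@le_trans _ _ (\int[sigma]_(z in A) ((N * r) `^ (- b))%:E)).
  by rewrite integral_cst// EFinM; apply: lee_wpmul2l => //; rewrite lee_fin powR_ge0.
apply: ge0_le_integral_subset.
- by move=> z [[Mz _] nBz].
- by move=> z _; rewrite lee_fin powR_ge0.
- by move=> z _; rewrite lee_fin invr_ge0 powR_ge0.
move=> z [[_ /ball_rVP[_ xz]] nBz].
have zx : (0 < edist z x)%R by apply: edist_gt0; apply/eqP => zx; apply: nBz; rewrite zx.
(* [ball] refers to the sup norm, whence the factor [N] for the Euclidean distance. *)
have zNr : (edist z x <= N * r)%R.
  by apply: edist_le_norm_coord => [|i]; [exact: ltW|rewrite distrC ltW].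
rewrite lee_fin powRN lef_pV2 ?posrE ?powR_gt0//; last exact: lt_le_trans zNr.
by apply: ge0_ler_powR => //; [exact: ltW|rewrite nnegrE edist_ge0|rewrite nnegrE (le_trans _ zNr)// edist_ge0].
Qed.

(* The radius at which the density bound gives boundary measure [4 m]. *)
Definition scale_radius (m : R) : R := (4 * m / density_constant R d) `^ (d%:R)^-1.

(** The minimum covers the two alternatives, each bounded below by a multiple of [r ^ (- t)]; the
    last factor turns this power of [r = scale_radius m] into [m ^ (- (t / d))]. *)
Definition kernel_constant (a t : R) : R :=
  (Num.min (N `^ (- (d%:R + t)) * (density_constant R d / 4)) (curvature_constant d a `^ (t / a)) *
   (4 / density_constant R d) `^ (- (t / d%:R)))%R.

Hypothesis d0 : (0 < d)%N.
Let dR0 : (d%:R != 0 :> R)%R. Proof. by rewrite pnatr_eq0 -lt0n. Qed.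
Let N0 : (0 < N)%R. Proof. by rewrite ltr0n. Qed.
Let dens0 : (0 < density_constant R d)%R. Proof. exact: density_constant_gt0. Qed.

Lemma kernel_constant_gt0 (a t : R) : (0 < a)%R -> (0 < kernel_constant a t)%R.
Proof.
move=> a0; apply: mulr_gt0; last by apply: powR_gt0; exact: divr_gt0.
rewrite lt_min; apply/andP; split; last exact/powR_gt0/curvature_constant_gt0.
by apply: mulr_gt0; [exact: powR_gt0|exact: divr_gt0].
Qed.

Lemma scale_radius_gt0 (m : R) : (0 < m)%R -> (0 < scale_radius m)%R.
Proof. by move=> m0; rewrite powR_gt0// divr_gt0// mulr_gt0. Qed.

Lemma scale_radius_density (m : R) : (0 < m)%R ->
  (density_constant R d * scale_radius m ^+ d = 4 * m)%R.
Proof.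
move=> m0; rewrite -powR_mulrn ?powR_ge0// -powRrM mulVf// powRr1; last first.
  by apply/ltW/divr_gt0 => //; exact: mulr_gt0.
by rewrite mulrC divfK// gt_eqF.
Qed.

Lemma scale_radius_powR (m t : R) : (0 < m)%R ->
  (scale_radius m `^ (- t) = (4 / density_constant R d) `^ (- (t / d%:R)) * m `^ (- (t / d%:R)))%R.
Proof.
move=> m0; rewrite -powRM; [|exact/ltW/divr_gt0|exact: ltW].
by rewrite /scale_radius -powRrM mulrN [(_^-1 * t)%R]mulrC mulrAC.
Qed.

(** The threshold is half the density bound. Above it the ball carries more than [2 m] of the
    boundary, as [integral_kernel_ge] requires; at or below it the density alternative of
    [boundary_dichotomy] is impossible, so the curvature is large. Cutting by the measure of the
    ball makes the set where each alternative is used measurable. *)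
Lemma kernel_or_curvature (a t m : R) (Omega B : set V) (x : V) :
  (0 < a)%R -> (0 < t)%R -> (0 < m)%R -> open Omega -> @convex_set R V Omega ->
  boundary Omega x ->
  measurable (B : set T) -> B x -> sigma B <= m%:E ->
  let r := scale_radius m in
  let g := (kernel_constant a t * m `^ (- (t / d%:R)))%:E in
  ((density_constant R d / 2 * r ^+ d)%:E < sigma (boundary Omega `&` ball x r) ->
   g <= \int[sigma]_(z in boundary Omega `\` B) ((edist z x `^ (d%:R + t))^-1)%:E) /\
  (sigma (boundary Omega `&` ball x r) <= (density_constant R d / 2 * r ^+ d)%:E ->
   g <= nonlocal_mean_curvature a Omega x `^ (t / a)).
Proof.
move=> a0 t0 m0 oO cO bx mB Bx Bm r g.
have r0 : (0 < r)%R by exact: scale_radius_gt0.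
have rd : (density_constant R d * r ^+ d = 4 * m)%R by exact: scale_radius_density.
have gE : g = ((Num.min (N `^ (- (d%:R + t)) * (density_constant R d / 4))
    (curvature_constant d a `^ (t / a))) * r `^ (- t))%:E.
  by rewrite /g /kernel_constant /r scale_radius_powR// -[in LHS]mulrA.
split=> [good|bad].
  have := @integral_kernel_ge (boundary Omega) B x (d%:R + t) m r.
  move=> /(_ (measurable_boundary oO) mB Bx).
  have -> : (2 * m = density_constant R d / 2 * r ^+ d)%R by rewrite mulrAC rd; field.
  move=> /(_ (addr_gt0 _ t0) m0 r0 Bm good); rewrite ltr0n => /(_ d0).
  apply: le_trans; rewrite gE lee_fin.
  have -> : ((N * r) `^ (- (d%:R + t)) * m =
     (N `^ (- (d%:R + t)) * (density_constant R d / 4)) * r `^ (- t))%R.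
    have -> : (m = density_constant R d / 4 * r ^+ d)%R by rewrite mulrAC rd; field.
    rewrite powRM ?(ltW N0) ?(ltW r0)// -!mulrA; congr (_ * _)%R.
    rewrite opprD powRD ?(gt_eqF r0) ?implybT// powR_invn ?(ltW r0)//.
    have : (r ^+ d != 0)%R by rewrite expf_neq0// gt_eqF.
    by move: (r ^+ d)%R (r `^ (- t))%R => A C A0; field; rewrite A0 gt_eqF.
  by rewrite ler_wpM2r ?powR_ge0// ge_min lexx.
have [dense|curved] := @boundary_dichotomy R d a Omega x r d0 a0 oO cO bx r0.
  have := le_trans dense bad; rewrite lee_fin leNgt => /negP; case.
  by rewrite ltr_pM2r ?exprn_gt0// ltr_pdivrMr// ltr_pMr// ltr1n.
have cr0 : (0 <= curvature_constant d a * r `^ (- a))%R.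
  by rewrite mulr_ge0 ?powR_ge0// ltW// curvature_constant_gt0.
have H0 : 0 <= nonlocal_mean_curvature a Omega x by apply: le_trans curved; rewrite lee_fin.
have ta0 : (0 <= t / a)%R by rewrite divr_ge0 ?ltW.
apply: (@le_trans _ _ ((curvature_constant d a * r `^ (- a))%R%:E `^ (t / a))); last first.
  by apply: gt0_ler_poweR curved => //; rewrite in_itv/= ?lee_fin ?cr0 ?H0 leey.
have c0 := ltW (curvature_constant_gt0 d a0).
rewrite poweR_EFin gE lee_fin (powRM _ c0 (powR_ge0 _ _)) -powRrM (_ : - a * (t / a) = - t)%R; last by field; rewrite gt_eqF.
by rewrite ler_wpM2r ?powR_ge0// ge_min lexx orbT.
Qed.

End kernel_bounds.

(** * The isoperimetric inequality *)

Section isoperimetric.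
Context (R : realType) (d : nat).
Local Notation V := 'rV[R]_d.+1.
Local Notation sigma := (surface_measure R d).
Local Notation T := (caratheodory_type (hausdorff_outer R d.+1 d)).

(** The argument is direct, without inserting an indicator function in the Sobolev inequality: the
    scale [m] is the measure of [E], so the pointwise lower bound [g] is constant on [E]. *)
Lemma fractional_isoperimetric (a t : R) (Omega E : set V) :
  (0 < d)%N -> (0 < a)%R -> (0 < t)%R -> (t < d%:R)%R ->
  open Omega -> @convex_set R V Omega ->
  E `<=` boundary Omega -> measurable (E : set T) -> sigma E < +oo ->
  sigma E `^ ((d%:R - t) / d%:R) <= ((kernel_constant d a t)^-1)%:E *
   (nonlocal_perimeter t (boundary Omega) E +
    \int[sigma]_(x in E) nonlocal_mean_curvature a Omega x `^ (t / a)).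
Proof.
move=> d0 a0 t0 td oO cO EM mE Eoo.
have dR0 : (0 < d%:R :> R)%R by rewrite ltr0n.
set k := kernel_constant d a t.
have k0 : (0 < k)%R by exact: kernel_constant_gt0.
have inner0 y : 0 <= \int[sigma]_(x in boundary Omega `\` E) ((edist x y `^ (d%:R + t))^-1)%:E.
  by apply: integral_ge0 => x _; rewrite lee_fin invr_ge0 powR_ge0.
have rhs0 : 0 <= nonlocal_perimeter t (boundary Omega) E +
    \int[sigma]_(x in E) nonlocal_mean_curvature a Omega x `^ (t / a).
  by apply: adde_ge0; apply: integral_ge0 => x _; [exact: inner0|exact: poweR_ge0].
(* A null set is treated apart, since the scale must be positive. *)
have [->|E0] := eqVneq (sigma E) 0.
  rewrite poweR0r; last by rewrite gt_eqF// divr_gt0// subr_gt0.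
  by rewrite mule_ge0// lee_fin invr_ge0 ltW.
have Efin : sigma E \is a fin_num by rewrite ge0_fin_numE.
pose m := fine (sigma E); have Em : sigma E = m%:E by rewrite fineK.
have m0 : (0 < m)%R by rewrite fine_gt0// lt0e E0 Eoo measure_ge0.
pose g := (k * m `^ (- (t / d%:R)))%R.
have key x (Ex : E x) := kernel_or_curvature d0 a0 t0 m0 oO cO (EM x Ex) mE Ex
  (eq_ind_r (fun u => u <= m%:E) (lexx _) Em).
have := @integral_dichotomy R d (boundary Omega) (measurable_boundary oO) E
  (fun=> scale_radius d m) (fun=> g)
  (fun y => \int[sigma]_(x in boundary Omega `\` E) ((edist x y `^ (d%:R + t))^-1)%:E)
  (fun x => nonlocal_mean_curvature a Omega x `^ (t / a)) (density_constant R d / 2)%R mE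
  (measurable_cst _) (measurable_cst _).
move=> /(_ (fun _ _ => mulr_ge0 (ltW k0) (powR_ge0 _ _)) (fun y _ => inner0 y)
  (fun _ _ => poweR_ge0 _ _) (fun x Ex => (key x Ex).1) (fun x Ex => (key x Ex).2)).
rewrite (integral_cst sigma mE) Em => mainineq.
have gm : (k^-1 * (g * m) = m `^ ((d%:R - t) / d%:R))%R.
  rewrite /g mulrBl mulfV ?gt_eqF// powRD ?(gt_eqF m0) ?implybT// powRr1 ?(ltW m0)//.
  by move: (m `^ _)%R => B; field; rewrite gt_eqF.
rewrite poweR_EFin -gm [leLHS]EFinM [in leLHS]EFinM.
by apply: lee_wpmul2l mainineq; rewrite lee_fin invr_ge0 ltW.
Qed.

End isoperimetric.

Lemma powR_div (R : realType) (x y b : R) : (0 <= x)%R -> (0 <= y)%R ->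
  ((x / y) `^ b = x `^ b * y `^ (- b))%R.
Proof.
by move=> x0 y0; rewrite powRM ?invr_ge0// -(powR_inv1 y0) -powRrM mulN1r.
Qed.

(** * The fractional Sobolev inequality *)

Section sobolev.
Context (R : realType) (d : nat).
Local Notation V := 'rV[R]_d.+1.
Local Notation sigma := (surface_measure R d).
Local Notation T := (caratheodory_type (hausdorff_outer R d.+1 d)).
Variables (a s p : R).
Hypotheses (d0 : (0 < d)%N) (a0 : (0 < a)%R) (s0 : (0 < s)%R) (p1 : (1 <= p)%R).
Hypothesis spd : (s * p < d%:R)%R.
Let q := sobolev_exponent d s p.
Let p0 : (0 < p)%R. Proof. exact: lt_le_trans p1. Qed.
Let dR0 : (0 < d%:R :> R)%R. Proof. by rewrite ltr0n. Qed.
Let sp0 : (0 < s * p)%R. Proof. exact: mulr_gt0. Qed.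
Let dsp0 : (0 < d%:R - s * p)%R. Proof. by rewrite subr_gt0. Qed.
Let q0 : (0 < q)%R. Proof. by rewrite divr_gt0// mulr_gt0. Qed.

(** The first factor comes from the oscillation [v x / 2] raised to the power [p], the last one from
    the factor [2 ^ q] in Chebyshev's bound. *)
Definition sobolev_constant : R :=
  (2 `^ (- p) * kernel_constant d a (s * p) * 2 `^ (- (q * (s * p / d%:R))))%R.

Lemma sobolev_constant_gt0 : (0 < sobolev_constant)%R.
Proof.
apply: mulr_gt0; last exact: powR_gt0.
by apply: mulr_gt0; [exact: powR_gt0|exact: kernel_constant_gt0].
Qed.

Variables (Omega : set V) (u : V -> R).
Hypotheses (oO : open Omega) (cO : @convex_set R V Omega).
Let M := boundary Omega.
Hypothesis mu : measurable_fun (M : set T) (u : T -> R).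
Let mM : measurable (M : set T). Proof. exact: measurable_boundary. Qed.

Let inner (y : V) := \int[sigma]_(x in M) (`|u x - u y| `^ p / (edist x y `^ (d%:R + s * p)))%:E.
Let curv (x : V) := nonlocal_mean_curvature a Omega x `^ (s * p / a) * (`|u x| `^ p)%:E.

Let inner_ge0 y : 0 <= inner y.
Proof. by apply: integral_ge0 => x _; rewrite lee_fin divr_ge0 ?powR_ge0. Qed.

Let curv_ge0 x : 0 <= curv x.
Proof. by rewrite mule_ge0 ?poweR_ge0// lee_fin powR_ge0. Qed.

Variable L : R.
Hypothesis L0 : (0 < L)%R.
Let v x := Num.min `|u x|%R L.

Let v_ge0 x : (0 <= v x)%R. Proof. by rewrite le_min normr_ge0 ltW. Qed.

Lemma measurable_truncation : measurable_fun (M : set T) (v : T -> R).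
Proof.
apply: measurable_minr; last exact: measurable_cst.
by apply: measurableT_comp; [exact: normr_measurable|exact: mu].
Qed.

Lemma measurable_truncation_powR (D : set V) (b : R) : measurable (D : set T) -> D `<=` M ->
  measurable_fun (D : set T) ((fun x => v x `^ b)%R : T -> R).
Proof.
move=> mD DM; apply: (@measurableT_comp _ _ _ _ _ _ (fun r : R => r `^ b)%R).
  exact: measurable_powR.
exact: measurable_funS mM DM measurable_truncation.
Qed.

Let superlevel (c : R) := M `&` [set x | (c < v x)%R].

Let measurable_superlevel c : measurable (superlevel c : set T).
Proof.
have := measurable_truncation mM (measurable_itv `]c, +oo[).
by rewrite set_itvE.
Qed.

Variable J : R.
Hypothesis J0 : (0 < J)%R.
Hypothesis JE : \int[sigma]_(x in M) (v x `^ q)%:E = J%:E.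

(* Chebyshev's bound for the measure of [v > v x / 2]. *)
Let m x := (J * 2 `^ q * v x `^ (- q))%R.

Let m_gt0 x : (0 < v x)%R -> (0 < m x)%R.
Proof. by move=> vx; rewrite !mulr_gt0 ?powR_gt0. Qed.

Lemma superlevel_measure_le x : (0 < v x)%R -> sigma (superlevel (v x / 2)) <= (m x)%:E.
Proof.
move=> vx; have v2 : (0 < v x / 2)%R by rewrite divr_gt0.
have : ((v x / 2) `^ q)%:E * sigma (superlevel (v x / 2)) <= J%:E.
  rewrite -(integral_cst sigma (measurable_superlevel _)) -JE; apply: ge0_le_integral_subset.
  - by move=> z [].
  - by move=> z _; rewrite lee_fin powR_ge0.
  - by move=> z _; rewrite lee_fin powR_ge0.
  move=> z [_ /= vz]; rewrite lee_fin ge0_ler_powR ?nnegrE ?(ltW q0) ?(ltW v2)//.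
  exact: ltW.
rewrite -lee_pdivlMl ?powR_gt0// => /le_trans; apply.
rewrite -EFinM lee_fin le_eqVlt; apply/predU1P; left.
rewrite /m powR_div ?(ltW vx)// !powRN.
have := powR_gt0 q vx; have := powR_gt0 q (ltr0n R 2).
by move: (2 `^ q)%R (v x `^ q)%R => A B A0 B0; field; rewrite !gt_eqF.
Qed.

(** Since [v z <= v x / 2 < L], the truncation is inactive at [z], so that [|u z|] itself is at most
    [v x / 2]. The bound thus concerns [u] and not only [v]. *)
Let oscillation x z : (0 < v x)%R -> M z -> ~ superlevel (v x / 2) z ->
  (v x / 2 <= `|u z - u x|)%R.
Proof.
move=> vx Mz nz; have vz : (v z <= v x / 2)%R.
  by rewrite leNgt; apply/negP => lt; apply: nz; split.
have vL : (v x <= L)%R by rewrite ge_min lexx orbT.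
have vu : (v x <= `|u x|)%R by rewrite ge_min lexx.
have uz : (`|u z| <= v x / 2)%R.
  by move: vz; rewrite {1}/v ge_min => /orP[//|]; lra.
rewrite distrC; apply: le_trans (lerB_dist _ _); lra.
Qed.

Lemma truncated_sobolev :
  (sobolev_constant * J `^ ((d%:R - s * p) / d%:R))%:E <=
  gagliardo_energy s p M u + \int[sigma]_(x in M) curv x.
Proof.
(* The scale [m x] is positive only where [v] is. Restricting to this set does not change the
   integral of [v ^ q]. *)
pose D := superlevel 0; have mD : measurable (D : set T) by exact: measurable_superlevel.
have DM : D `<=` M by move=> x [].
pose A := (2 `^ (- p) * kernel_constant d a (s * p) * (J * 2 `^ q) `^ (- (s * p / d%:R)))%R.
pose g x := (A * v x `^ q)%R.
have k0 := kernel_constant_gt0 d (s * p) a0.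
have A0 : (0 <= A)%R.
  by apply/mulr_ge0/powR_ge0/mulr_ge0/ltW/k0; exact: powR_ge0.
have gE x : (0 < v x)%R ->
    (g x = (v x / 2) `^ p * (kernel_constant d a (s * p) * m x `^ (- (s * p / d%:R))))%R.
  move=> vx; rewrite /g /A /m [in RHS]powRM ?mulr_ge0 ?powR_ge0 ?(ltW J0)//.
  rewrite [in RHS]powR_div ?(ltW vx)//.
  (* The critical exponent is the one satisfying [q = p + q s p / d]. *)
  have -> : (v x `^ q = v x `^ p * (v x `^ (- q)) `^ (- (s * p / d%:R)))%R.
    rewrite -powRrM -powRD ?(gt_eqF vx) ?implybT//; congr (_ `^ _)%R.
    by rewrite /q /sobolev_exponent; field; rewrite !gt_eqF.
  by ring.
have mr : measurable_fun (D : set T) ((fun x => scale_radius d (m x)) : T -> R).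
  apply: (@measurableT_comp _ _ _ _ _ _ (fun r : R => r `^ (d%:R)^-1)%R); first exact: measurable_powR.
  apply: measurable_funM; last exact: measurable_cst.
  apply: measurable_funM; first exact: measurable_cst.
  apply: measurable_funM; first exact: measurable_cst.
  exact: measurable_truncation_powR.
have mg : measurable_fun (D : set T) (g : T -> R).
  by apply: measurable_funM; [exact: measurable_cst|exact: measurable_truncation_powR].
have half x : D x -> superlevel (v x / 2) x.
  by move=> [Mx /= vx]; split=> //=; rewrite ltr_pdivrMr// ltr_pMr// ltr1n.
have keyx x (Dx : D x) := kernel_or_curvature d0 a0 sp0 (m_gt0 Dx.2) oO cO Dx.1
  (measurable_superlevel (v x / 2)) (half x Dx) (superlevel_measure_le Dx.2).
have mk (B : set V) x : measurable_fun (B : set T)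
    ((fun z => ((edist z x `^ (d%:R + s * p))^-1)%:E) : T -> \bar R).
  apply/measurable_EFinP.
  rewrite (_ : (fun z => _) = (fun z : T => edist (z : V) x `^ (- (d%:R + s * p)))%R); last first.
    by apply/funext => z; rewrite powRN.
  apply: (@measurableT_comp _ _ _ _ _ _ (fun r : R => r `^ (- (d%:R + s * p)))%R).
    exact: measurable_powR.
  exact/measurable_funTS/surface_continuous/continuous_edist.
have g_inner x : D x -> (density_constant R d / 2 * scale_radius d (m x) ^+ d)%:E <
    sigma (M `&` ball x (scale_radius d (m x))) -> (g x)%:E <= inner x.
  move=> Dx /(keyx x Dx).1 kx; rewrite gE; last exact: Dx.2.
  rewrite EFinM; apply: (@le_trans _ _ (((v x / 2) `^ p)%:E *
      \int[sigma]_(z in M `\` superlevel (v x / 2)) ((edist z x `^ (d%:R + s * p))^-1)%:E)).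
    by apply: lee_wpmul2l kx; rewrite lee_fin powR_ge0.
  rewrite -(ge0_integralZl_EFin sigma (measurableD mM (measurable_superlevel (v x / 2)))
    _ (mk _ _) (powR_ge0 _ _)); last by move=> z _; rewrite lee_fin invr_ge0 powR_ge0.
  apply: ge0_le_integral_subset.
  - by move=> z [].
  - by move=> z _; rewrite -EFinM lee_fin mulr_ge0 ?invr_ge0 ?powR_ge0.
  - by move=> z _; rewrite lee_fin divr_ge0 ?powR_ge0.
  move=> z [Mz nz]; rewrite -EFinM lee_fin ler_wpM2r ?invr_ge0 ?powR_ge0//.
  apply: ge0_ler_powR; rewrite ?nnegrE ?normr_ge0 ?divr_ge0//; first exact: ltW.
  exact: oscillation Dx.2 Mz nz.
have g_curv x : D x -> sigma (M `&` ball x (scale_radius d (m x))) <=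
    (density_constant R d / 2 * scale_radius d (m x) ^+ d)%:E -> (g x)%:E <= curv x.
  move=> Dx /(keyx x Dx).2 kx; rewrite gE; last exact: Dx.2.
  rewrite mulrC EFinM /curv; apply: lee_pmul kx _.
  - by rewrite lee_fin; apply/mulr_ge0/powR_ge0/ltW.
  - by rewrite lee_fin powR_ge0.
  rewrite lee_fin; apply: ge0_ler_powR; rewrite ?nnegrE ?normr_ge0 ?divr_ge0//; first exact: ltW.
  apply: (@le_trans _ _ (v x)); last by rewrite ge_min lexx.
  by rewrite ler_pdivrMr// ler_peMr// ler1n.
have g0 x : D x -> (0 <= g x)%R by move=> _; apply/mulr_ge0/powR_ge0.
have := integral_dichotomy mM mD mr mg g0 (fun x _ => inner_ge0 x) (fun x _ => curv_ge0 x)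
  g_inner g_curv.
have -> : \int[sigma]_(x in D) (g x)%:E = (A * J)%:E.
  rewrite EFinM -JE (_ : \int[sigma]_(x in M) _ = \int[sigma]_(x in D) (v x `^ q)%:E).
    rewrite -(ge0_integralZl_EFin sigma mD _ _ A0) => [|x _|]; first exact: eq_integral.
      by rewrite lee_fin powR_ge0.
    by apply/measurable_EFinP; exact: measurable_truncation_powR.
  rewrite /D /superlevel [RHS]integral_mkcondr; apply: eq_integral => x _; rewrite patchE; case: ifPn => // /negP nx.
  have -> : v x = 0%R.
    apply/eqP; rewrite eq_le v_ge0 andbT leNgt; apply/negP => vx; apply: nx.
    by rewrite inE.
  by rewrite powR0// gt_eqF.
have -> : (A * J = sobolev_constant * J `^ ((d%:R - s * p) / d%:R))%R.
  rewrite /A /sobolev_constant powRM ?powR_ge0 ?(ltW J0)// -powRrM mulrN mulrBl mulfV ?gt_eqF//.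
  rewrite powRD ?(gt_eqF J0) ?implybT// powRr1 ?(ltW J0)//.
  by ring.
move=> main; apply: le_trans main _; apply: leeD.
  apply: ge0_le_integral_subset => // x _; exact: inner_ge0.
by apply: ge0_le_integral_subset => // x _; exact: curv_ge0.
Qed.

End sobolev.

Lemma Lp_normE (R : realType) (d : nat) (r : R) (M : set 'rV[R]_d.+1) (u : 'rV[R]_d.+1 -> R) :
  (0 < r)%R ->
  Lp_norm r M u = (\int[surface_measure R d]_(x in M) (`|u x| `^ r)%:E) `^ r^-1.
Proof.
move=> r0; rewrite /Lp_norm unlock; congr (_ `^ _).
rewrite [RHS]integral_mkcond; apply: eq_integral => x _ /=; rewrite !patchE.
by case: ifP => _; rewrite /= ?normr0 ?powR0 ?gt_eqF.
Qed.

Lemma fractional_sobolev (R : realType) (d : nat) (a s p : R) (Omega : set 'rV[R]_d.+1)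
    (u : 'rV[R]_d.+1 -> R) :
  (0 < d)%N -> (0 < a)%R -> (0 < s)%R -> (1 <= p)%R -> (s * p < d%:R)%R ->
  open Omega -> @convex_set R 'rV[R]_d.+1 Omega -> frac_sobolev s p (boundary Omega) u ->
  Lp_norm (sobolev_exponent d s p) (boundary Omega) u <=
  ((2 / sobolev_constant d a s p) `^ p^-1)%:E *
  (2^-1%:E * gagliardo_energy s p (boundary Omega) u +
   \int[surface_measure R d]_(x in boundary Omega)
     (nonlocal_mean_curvature a Omega x `^ (s * p / a) * (`|u x| `^ p)%:E)) `^ p^-1.
Proof.
move=> d0 a0 s0 p1 spd oO cO [mu Lpu _].
set M := boundary Omega; set q := sobolev_exponent d s p; set sigma := surface_measure R d.
set E := gagliardo_energy s p M u; set I := \int[sigma]_(x in M) _.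
set c := sobolev_constant d a s p.
have p0 : (0 < p)%R by exact: lt_le_trans p1.
have dR0 : (0 < d%:R :> R)%R by rewrite ltr0n.
have dsp0 : (0 < d%:R - s * p)%R by rewrite subr_gt0.
have q0 : (0 < q)%R by rewrite divr_gt0// mulr_gt0.
have c0 : (0 < c)%R by exact: sobolev_constant_gt0.
have pq : (p <= q)%R.
  by rewrite ler_pdivlMr// mulrC ler_wpM2r ?(ltW p0)// gerBl mulr_ge0 ?ltW.
have mM : measurable (M : set (caratheodory_type (hausdorff_outer R d.+1 d))).
  exact: measurable_boundary.
have E0 : 0 <= E.
  by apply: integral_ge0 => y _; apply: integral_ge0 => x _; rewrite lee_fin divr_ge0 ?powR_ge0.
have I0 : 0 <= I.
  by apply: integral_ge0 => x _; rewrite mule_ge0 ?poweR_ge0// lee_fin powR_ge0.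
have c2 : (0 < 2 / c)%R by exact: divr_gt0.
have upfin : \int[sigma]_(x in M) (`|u x| `^ p)%:E < +oo.
  by move: Lpu; rewrite Lp_normE// => /lty_poweRy; apply; rewrite gt_eqF// invr_gt0.
have [RHSoo|RHSoo] := eqVneq (2^-1%:E * E + I) +oo.
  by rewrite RHSoo poweRyr ?gt_eqF ?invr_gt0// gt0_muley ?leey// lte_fin powR_gt0.
have RHS0 : 0 <= 2^-1%:E * E + I by rewrite adde_ge0// mule_ge0// lee_fin invr_ge0.
have RHSfin : 2^-1%:E * E + I \is a fin_num by rewrite ge0_fin_numE// ltey.
set r := fine (2^-1%:E * E + I).
have rE : 2^-1%:E * E + I = r%:E by rewrite fineK.
have r0 : (0 <= r)%R by exact: fine_ge0.
(* The factor [2] absorbs the one half in front of the energy; it reappears in the final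
   constant. *)
have EI : E + I <= (2 * r)%:E.
  rewrite EFinM -rE ge0_muleDr ?mule_ge0 ?lee_fin ?invr_ge0// muleA -EFinM divff//.
  by rewrite mul1e leeD// -[leLHS]mul1e; apply: lee_wpmul2r => //; rewrite lee_fin ler1n.
pose v (k : nat) x : R := Num.min `|u x|%R k.+1%:R.
have mv k : measurable_fun (M : set (caratheodory_type (hausdorff_outer R d.+1 d)))
    ((fun x => (v k x `^ q)%:E) : caratheodory_type (hausdorff_outer R d.+1 d) -> \bar R).
  apply/measurable_EFinP.
  exact: (measurable_truncation_powR oO mu (k.+1%:R) q mM (@subset_refl _ M)).
have v0 k x : (0 <= v k x)%R by rewrite le_min normr_ge0 ler0n.
(* [K] solves [c * K ^ ((d - s p) / d) = 2 r], so it bounds the integral of [v ^ q] uniformly in the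
   truncation level. *)
set K := ((2 / c * r) `^ (d%:R / (d%:R - s * p)))%R.
have bound k : \int[sigma]_(x in M) (v k x `^ q)%:E <= K%:E.
  have J0 : 0 <= \int[sigma]_(x in M) (v k x `^ q)%:E.
    by apply: integral_ge0 => x _; rewrite lee_fin powR_ge0.
  (* Membership of [u] in [L^p] enters here: [v ^ q] is at most [(k + 1) ^ (q - p)] times
     [|u| ^ p]. *)
  have Jfin : \int[sigma]_(x in M) (v k x `^ q)%:E \is a fin_num.
    rewrite (ge0_fin_numE J0).
    apply: (@le_lt_trans _ _ (\int[sigma]_(x in M) ((k.+1%:R `^ (q - p))%:E * (`|u x| `^ p)%:E))).
      apply: ge0_le_integral_subset => // x _; rewrite ?lee_fin ?powR_ge0//.
      have -> : (v k x `^ q = v k x `^ (q - p) * v k x `^ p)%R.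
        by rewrite -powRD subrK// (gt_eqF q0).
      apply: ler_pM; rewrite ?powR_ge0//; apply: ge0_ler_powR;
        rewrite ?nnegrE ?subr_ge0 ?ler0n ?normr_ge0 ?(ltW p0)// ge_min lexx ?orbT//.
    have mup : measurable_fun (M : set (caratheodory_type (hausdorff_outer R d.+1 d)))
        ((fun x => (`|u x| `^ p)%:E) : caratheodory_type (hausdorff_outer R d.+1 d) -> \bar R).
      apply/measurable_EFinP.
      apply: (@measurableT_comp _ _ _ _ _ _ (fun t : R => t `^ p)%R); first exact: measurable_powR.
      by apply: measurableT_comp; [exact: normr_measurable|exact: mu].
    have up0 x : M x -> 0 <= (`|u x| `^ p)%:E by rewrite lee_fin powR_ge0.
    rewrite (ge0_integralZl_EFin sigma mM up0 mup (powR_ge0 _ _)).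
    by rewrite lte_mul_pinfty// lee_fin powR_ge0.
  have [->|Jn0] := eqVneq (\int[sigma]_(x in M) (v k x `^ q)%:E) 0.
    by rewrite lee_fin powR_ge0.
  set J := fine (\int[sigma]_(x in M) (v k x `^ q)%:E).
  have JE : \int[sigma]_(x in M) (v k x `^ q)%:E = J%:E by rewrite fineK.
  have Jgt0 : (0 < J)%R by rewrite fine_gt0// lt0e Jn0 J0 -ge0_fin_numE.
  have := truncated_sobolev d0 a0 s0 p1 spd oO cO mu (ltr0Sn R k) Jgt0 JE.
  move=> /le_trans /(_ EI); rewrite lee_fin -/c mulrC -ler_pdivlMr// => JK.
  rewrite JE lee_fin.
  have -> : (J = (J `^ ((d%:R - s * p) / d%:R)) `^ (d%:R / (d%:R - s * p)))%R.
    by rewrite -powRrM mulrA divfK ?gt_eqF// mulfV ?gt_eqF// powRr1// ltW.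
  apply: ge0_ler_powR; rewrite ?nnegrE ?powR_ge0//.
  - by rewrite divr_ge0// ltW.
  - by rewrite mulr_ge0// ltW.
  - by rewrite mulrAC.
have uK : \int[sigma]_(x in M) (`|u x| `^ q)%:E <= K%:E.
  have -> : \int[sigma]_(x in M) (`|u x| `^ q)%:E =
      \int[sigma]_(x in M) limn (fun k => (v k x `^ q)%:E).
    (* At each point the truncations are constant once [k + 1] exceeds [|u x|]. *)
    apply: eq_integral => x _; apply/esym/cvg_lim => //; apply: cvg_near_cst.
    exists (Num.truncn `|u x|) => // k /= uk; congr (_ `^ _)%:E; apply/min_idPl.
    apply/ltW/(lt_le_trans (truncnS_gt _)); rewrite ler_nat ltnS; exact: uk.
  rewrite (monotone_convergence sigma mM mv).
  - apply: lime_le; last by near=> k; exact: bound.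
    apply: ereal_nondecreasing_is_cvgn => j k jk.
    apply: ge0_le_integral_subset => // x _; rewrite ?lee_fin ?powR_ge0//.
    apply: ge0_ler_powR; rewrite ?nnegrE ?(ltW q0)// le_min ge_min lexx/=.
    by rewrite ge_min ler_nat ltnS jk orbT.
  - by move=> k x _; rewrite lee_fin powR_ge0.
  - move=> x _ j k jk; rewrite lee_fin; apply: ge0_ler_powR; rewrite ?nnegrE ?(ltW q0)//.
    by rewrite le_min ge_min lexx/= ge_min ler_nat ltnS jk orbT.
rewrite Lp_normE// rE poweR_EFin -EFinM -powRM//; last exact: ltW.
(* The exponents match because [d / (d - s p)] divided by [q] is [1 / p]. *)
have -> : ((2 / c * r) `^ p^-1)%:E = K%:E `^ q^-1.
  rewrite poweR_EFin /K -powRrM; congr (_ `^ _)%:E.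
  by rewrite /q /sobolev_exponent; field; rewrite !gt_eqF.
have U0 : 0 <= \int[sigma]_(x in M) (`|u x| `^ q)%:E.
  by apply: integral_ge0 => x _; rewrite lee_fin powR_ge0.
have K0 : 0 <= K%:E by rewrite lee_fin powR_ge0.
apply: gt0_ler_poweR uK; first by rewrite invr_ge0 ltW.
  by rewrite in_itv /= leey andbT; exact: U0.
by rewrite in_itv /= leey andbT; exact: K0.
Unshelve. all: by end_near. Qed.

Lemma nonlocal_perimeter_full (R : realType) (d : nat) (t : R) (M : set 'rV[R]_d.+1) :
  nonlocal_perimeter t M M = 0.
Proof. by apply: integral0_eq => y _; rewrite setDv integral_set0. Qed.

Theorem theorem1p3 (R : realType) (n : nat) (alpha s : R)
    (hn : (1 <= n)%N) (halpha : (0 < alpha < 1)%R) (hs : (0 < s < 1)%R) :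
  (forall p : R, (1 <= p)%R -> (s * p < n%:R)%R ->
     exists C : R, (0 < C)%R /\
       forall Omega : set 'rV[R]_n.+1,
         open Omega -> @convex_set R 'rV[R]_n.+1 Omega ->
         forall u : 'rV[R]_n.+1 -> R, frac_sobolev s p (boundary Omega) u ->
           Lp_norm (sobolev_exponent n s p) (boundary Omega) u <=
           C%:E *
           (2^-1%:E * gagliardo_energy s p (boundary Omega) u +
            \int[surface_measure R n]_(x in boundary Omega)
              (nonlocal_mean_curvature alpha Omega x `^ (s * p / alpha) *
               (`|u x| `^ p)%:E)) `^ p^-1) /\
  (exists C : R, (0 < C)%R /\
     forall Omega : set 'rV[R]_n.+1,
       open Omega -> @convex_set R 'rV[R]_n.+1 Omega ->
       (forall E : set 'rV[R]_n.+1,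
          E `<=` boundary Omega ->
          measurable (E : set (caratheodory_type (@hausdorff_outer R n.+1 n))) ->
          surface_measure R n E < +oo ->
          surface_measure R n E `^ ((n%:R - s) / n%:R) <=
          C%:E * (nonlocal_perimeter s (boundary Omega) E +
                  \int[surface_measure R n]_(x in E)
                    nonlocal_mean_curvature alpha Omega x `^ (s / alpha))) /\
       (surface_measure R n (boundary Omega) < +oo ->
        surface_measure R n (boundary Omega) `^ ((n%:R - s) / n%:R) <=
        C%:E * \int[surface_measure R n]_(x in boundary Omega)
                 nonlocal_mean_curvature alpha Omega x `^ (s / alpha))).
Proof.
have [a0 _] := andP halpha; have [s0 s1] := andP hs.
split=> [p p1 spn|].
  exists ((2 / sobolev_constant n alpha s p) `^ p^-1)%R; split.
    by apply: powR_gt0; apply: divr_gt0; [exact: ltr0n|exact: sobolev_constant_gt0].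
  by move=> Omega oO cO u; exact: fractional_sobolev.
have sn : (s < n%:R)%R by rewrite (lt_le_trans s1)// ler1n.
exists ((kernel_constant n alpha s)^-1)%R; split.
  by rewrite invr_gt0; exact: kernel_constant_gt0.
move=> Omega oO cO; split=> [E EM mE|Mfin].
  exact: fractional_isoperimetric.
(* For [E] the whole boundary the perimeter is an integral over the empty set, and only the
   curvature term remains. *)
have := fractional_isoperimetric hn a0 s0 sn oO cO (@subset_refl _ (boundary Omega))
  (measurable_boundary oO) Mfin.
by rewrite nonlocal_perimeter_full add0e.
Qed.
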